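(* Let $n \ge 2$ and $H \ge 1$ be two integers. (i) For any odd integer $k$ satisfying $1 \le k \le n$, we have $I_n(k,H) \sim (2H)^{n/k}$ as $H \to \infty$ if $k \mid n$, and $I_n(k,H)=0$ if $k \nmid n$. (ii) For any integer $k$ with $1 \le k \le n$, we have $$I_n(k,H) \ll H^{n-(k-1)/2}.$$ (iii) For even $n \ge 2$, we have $$I_n(n,H) \gg H^{\frac{n}{8}+\frac{2}{n}+\frac{1}{4}}.$$
   Context: For a polynomial $f$ of degree $n \ge 1$ over $\mathbb{C}$ with roots $\alpha_1,\dots,\alpha_n$ (not necessarily distinct), put $r(f)=\max_{1\le i\le n}|\alpha_i|$. The roots of $f$ of maximal modulus are the roots of modulus $r(f)$; they are counted with multiplicity. The height of $f$ is the maximum of the absolute values of its coefficients. For positive integers $k\le n$ and $H$, $I_n(k,H)$ denotes the number of monic irreducible integer polynomials $f$ of degree $n$ and height at most $H$ with exactly $k$ (not necessarily distinct) roots of maximal modulus. For two positive quantities $U,V$ (depending on $k,n,H$), $U \ll V$ or, equivalently, $V \gg U$ means that $U \le cV$ for some positive constant $c$ which may depend on $k$ and $n$ but does not depend on $H$; $U \sim V$ means $\lim_{H\to\infty} U/V = 1$.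
   Formalization: In (iii) the bound is asserted for all H ≥ 2, and for H = 1 only when I_n(n,1) > 0; otherwise it fails, e.g. n = 14, H = 1, where I_14(14,1) = 0 because no cyclotomic polynomial has degree 14. *)

(* Defs.v *)
From HB Require Import structures.
From mathcomp Require Import all_boot all_order all_algebra finmap.
From mathcomp Require Import all_classical all_reals all_analysis.
From mathcomp Require Import complex.

Set Implicit Arguments.
Unset Strict Implicit.
Unset Printing Implicit Defensive.

Import Order.TTheory GRing.Theory Num.Theory.
Import numFieldNormedType.Exports.

Local Open Scope classical_set_scope.
Local Open Scope ring_scope.

(* The roots with multiplicity: p = lead_coef p *: \prod_(z <- croots p) ('X - z%:P),
   and croots p is [::] when p is constant. *)
Definition croots (R : realType) (p : {poly R[i]}) : seq R[i] :=
  sval (closed_field_poly_normal p).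

Definition max_modulus (R : realType) (p : {poly R[i]}) : R :=
  \big[Num.max/0]_(z <- croots p) Normc.normc z.

Definition nb_max_modulus_roots (R : realType) (p : {poly R[i]}) : nat :=
  count (fun z => Normc.normc z == max_modulus p) (croots p).

Definition height (f : {poly int}) : nat := (\max_(i < size f) `|(f`_i)%R|)%N.

(* A monic integer polynomial is irreducible over the integers if and only if
   it is irreducible over the rationals (Gauss); irreducible_poly is meant for
   polynomials over a field, hence the map to {poly rat}. *)
Definition max_modulus_polys (R : realType) (n k H : nat) : set {poly int} :=
  [set f | [/\ f \is monic, size f = n.+1, (height f <= H)%N,
     irreducible_poly (map_poly (intr : int -> rat) f) &
     nb_max_modulus_roots (map_poly (intr : int -> R[i]) f) = k]].

(* fset_set is the empty set on infinite sets, so its cardinal is the intended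
   count only because of this finiteness. *)
Lemma finite_max_modulus_polys (R : realType) (n k H : nat) :
  finite_set (max_modulus_polys R n k H).
Proof.
pose g (u : {ffun 'I_n.+1 -> 'I_(H + H).+1}) : {poly int} :=
  \poly_(i < n.+1) ((u (inord i) : nat)%:Z - H%:Z).
apply: (@sub_finite_set _ _ (g @` [set: {ffun 'I_n.+1 -> 'I_(H + H).+1}])); last first.
  exact/finite_image/finite_finset.
move=> f [_ sf hf _ _].
have fH (i : 'I_n.+1) : (- H%:Z <= f`_i <= H%:Z)%R.
  rewrite -ler_norml -abszE lez_nat; apply: leq_trans hf.
  have ilt : (i < size f)%N by rewrite sf.
  exact: (leq_bigmax (Ordinal ilt)).
exists [ffun i : 'I_n.+1 => inord `|(f`_i + H%:Z)%R|%N] => //.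
apply/polyP => i; rewrite coef_poly; case: ltnP => [lin|]; last first.
  by rewrite -sf => /(nth_default 0).
rewrite ffunE inordK.
  rewrite inordK // gez0_abs ?addrK //.
  by have /andP[] := fH (Ordinal lin); rewrite /= lerNl -subr_ge0 opprK addrC.
rewrite inordK // ltnS -lez_nat gez0_abs.
  by have /andP[_] := fH (Ordinal lin); rewrite PoszD lerD2r.
by have /andP[] := fH (Ordinal lin); rewrite /= lerNl -subr_ge0 opprK addrC.
Qed.

Definition nb_max_modulus_polys (R : realType) (n k H : nat) : nat :=
  #|` fset_set (max_modulus_polys R n k H)|.

(* Main.v *)
(* For odd k, a root of maximal modulus of f is real, and relations a * a^* = r ^ 2
   between the roots of maximal modulus force f = g(X ^ k). Conversely, almost all
   monic g have a single root of maximal modulus, because the coefficient after the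
   leading one is of order H while all roots but one are bounded; then g(X ^ k) is
   irreducible unless g has a divisor from a finite list or +- g(0) is a proper
   power. For (ii), Landau's inequality gives r ^ k = O(H), which bounds the first k
   coefficients by powers of r. For (iii), the polynomials X ^ m g(X + rho / X), with
   m = n / 2, have all roots of modulus sqrt rho as soon as g has real roots in the
   interval of radius 2 sqrt rho; there are many Eisenstein polynomials g near a
   scaled split polynomial, and irreducibility is inherited from g. *)
Require Import Defs.
From HB Require Import structures.
From mathcomp Require Import all_boot all_order all_algebra finmap.
From mathcomp Require Import all_classical all_reals all_analysis.
From mathcomp Require Import complex.
From mathcomp Require polyrcf.
From mathcomp Require Import separable algC.
From mathcomp Require Import zify ring lra.

Set Implicit Arguments.
Unset Strict Implicit.
Unset Printing Implicit Defensive.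

Import Order.TTheory GRing.Theory Num.Theory.
Import numFieldNormedType.Exports.

Local Open Scope classical_set_scope.
Local Open Scope ring_scope.

(** Conjugacy enters through multiplicities only: a rational polynomial vanishes to the same order
    at all roots of an irreducible one. It is applied to polynomials with explicit lists of complex
    roots (products of two roots, powers of roots), whose rationality is the delicate point and
    comes from a determinant. In the limit, the exceptional g lie in at most 4 H / D + K sets, in
    each of which one coefficient is determined by the others. The term 4 H / D is not o(H): asking
    the subleading coefficient to be at least H / D discards a positive proportion. So D is chosen
    from the tolerance of the limit, and only then does H grow. In the lower bound rho varies too.
    With n = 2 m, sqrt rho of order Y and H of order Y ^ n, there are about Y ^ 2 values of rho and
    Y ^ j values of the coefficient of X ^ (m - j) in g; the exponent n / 8 + 2 / n + 1 / 4 is (2 +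
    m (m + 1) / 2) / (2 m), where the variation of rho accounts for 2 / n. *)

Local Notation pZtoQ := (map_poly (intr : int -> rat)).

(** * Rational polynomials and their complex roots *)

(* Multiplication by B modulo u has a matrix over F[X], which the Vandermonde
   matrix of the roots of u diagonalises with eigenvalues B(X, z); the product
   is its determinant. This replaces symmetric functions and Galois theory. *)
Lemma prod_horner_roots (F L : fieldType) (iota : {rmorphism F -> L})
    (u : {poly F}) (s : seq L) (B : {poly {poly F}}) :
  u \is monic -> map_poly iota u = \prod_(z <- s) ('X - z%:P) -> uniq s ->
  exists Q : {poly F},
    map_poly iota Q = \prod_(z <- s) (map_poly (map_poly iota) B).[z%:P].
Proof.
move=> mu us uniqs; pose n := size s.
have szu : size u = n.+1.
  by rewrite -(size_map_poly iota u) us size_prod_XsubC.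
(* [U] is u in the outer variable, the one evaluated at the roots; the inner variable survives in
   the determinant. *)
pose U : {poly {poly F}} := map_poly polyC u.
have mU : U \is monic by rewrite map_monic.
have szU : size U = n.+1 by rewrite size_map_polyC.
pose j0 := map_poly (map_poly iota) : {poly {poly F}} -> {poly {poly L}}.
pose M : 'M[{poly F}]_n := \matrix_(i, j) (Pdiv.Ring.rmodp ('X^i * B) U)`_j.
pose a : 'rV[{poly L}]_n := \row_j (s`_j)%:P.
pose V := Vandermonde n a.
have VN0 : \det V != 0.
  rewrite det_Vandermonde; apply/prodf_neq0 => i _; apply/prodf_neq0 => j ij.
  rewrite !mxE -polyCB polyC_eq0 subr_eq0 nth_uniq //.
  by rewrite neq_ltn ij orbT.
have U0 (l : 'I_n) : (j0 U).[(s`_l)%:P] = 0.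
  have -> : j0 U = map_poly polyC (map_poly iota u).
    by rewrite /j0 /U -!map_poly_comp; apply: eq_map_poly => x /=; rewrite map_polyC.
  rewrite horner_map /= us horner_prod (big_nth 0) big_mkord (bigD1 l) //=.
  by rewrite hornerXsubC subrr mul0r.
have MV : map_mx (map_poly iota) M *m V =
          V *m diag_mx (\row_j (j0 B).[(s`_j)%:P]).
  apply/matrixP => i l; rewrite mul_mx_diag !mxE.
  transitivity (j0 (Pdiv.Ring.rmodp ('X^i * B) U)).[(s`_l)%:P].
    rewrite (@horner_coef_wide _ n); last first.
      rewrite (leq_trans (size_poly _ _)) // -ltnS -szU.
      by apply: Pdiv.Ring.ltn_rmodpN0; apply: monic_neq0.
    by apply: eq_bigr => j _; rewrite !mxE coef_map.
  have := congr1 (fun p => (j0 p).[(s`_l)%:P]) (Pdiv.RingMonic.rdivp_eq mU ('X^i * B)).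
  rewrite /j0 rmorphD !rmorphM /= hornerD !hornerM (U0 l) mulr0 add0r => <-.
  by rewrite map_polyXn hornerXn.
exists (\det M); rewrite -det_map_mx; apply: (mulIf VN0).
rewrite -det_mulmx MV det_mulmx mulrC det_diag; congr (_ * _).
by rewrite (big_nth 0) big_mkord; apply: eq_bigr => i _; rewrite mxE.
Qed.

(** Coprimality is preserved by field extension, so coprime polynomials have no common root even in
    [L]. This makes any irreducible polynomial with root z act as the minimal polynomial of z. *)
Lemma irr_dvd_common_root (F L : fieldType) (iota : {rmorphism F -> L})
    (h p : {poly F}) (z : L) :
  irreducible_poly h -> root (map_poly iota h) z -> root (map_poly iota p) z ->
  h %| p.
Proof.
move=> irrh hz pz; apply: contraTT isT => hp.
have := irreducible_poly_coprime p irrh; rewrite hp -(coprimep_map iota).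
by move=> /coprimep_root /(_ hz); rewrite (eqP pz) eqxx.
Qed.

Lemma irr_root_minimal (F L : fieldType) (iota : {rmorphism F -> L})
    (p : {poly F}) (z : L) :
  p != 0 -> root (map_poly iota p) z ->
  exists u : {poly F},
    [/\ u \is monic, irreducible_poly u & root (map_poly iota u) z].
Proof.
move=> p0 pz.
pose P m := `[< exists2 q : {poly F}, q != 0 & (size q == m) && root (map_poly iota q) z >].
have exP : exists m, P m by exists (size p); apply/asboolP; exists p; rewrite // eqxx.
case: (ex_minnP exP) => m /asboolP[q q0 /andP[/eqP sq qz]] minm.
exists ((lead_coef q)^-1 *: q); have lq0 : lead_coef q != 0 by rewrite lead_coef_eq0.
split.
- by rewrite monicE lead_coefZ mulVf.
- split.
    rewrite size_scale ?invr_eq0 // ltnNge; apply/negP => /size1_polyC qE.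
    by move: qz q0; rewrite qE map_polyC rootC fmorph_eq0 /= polyC_eq0 => ->.
  move=> d sd; rewrite dvdpZr ?invr_eq0 // => /dvdpP[e qE].
  rewrite (eqp_rtrans (eqp_scale _ _)) ?invr_eq0 // -dvdp_size_eqp; last first.
    by apply/dvdpP; exists e.
  have [e0 d0] : e != 0 /\ d != 0.
    by split; apply: contra_neq q0 => q0; rewrite qE q0 ?mul0r ?mulr0.
  move: qz; rewrite qE rmorphM rootM => /orP[ez|dz].
    have := minm (size e); rewrite -sq qE size_mul // => H.
    have : P (size e) by apply/asboolP; exists e; rewrite // eqxx.
    move/H; have := size_poly_eq0 d; rewrite (negbTE d0).
    by case: (size d) sd => [|[|k]] //= _ _; rewrite addnS /= addnS ltnNge leq_addr.
  have /minm : P (size d) by apply/asboolP; exists d; rewrite // eqxx.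
  by rewrite -sq qE eqn_leq => ->; rewrite andbT dvdp_leq ?dvdp_mull ?mulf_neq0.
- by rewrite map_polyZ rootZ //= ?fmorph_eq0 ?invr_eq0.
Qed.

Lemma max_power_factor (F : fieldType) (h Q : {poly F}) :
  (1 < size h)%N -> Q != 0 -> exists e Q', Q = h ^+ e * Q' /\ ~~ (h %| Q').
Proof.
move=> sh; have [m] := ubnP (size Q); elim: m Q => // m IH Q.
rewrite ltnS => sQ Q0; have [/dvdpP[Q1 QE]|] := boolP (h %| Q); last first.
  by exists 0%N, Q; rewrite expr0 mul1r.
have Q10 : Q1 != 0 by apply: contra_neq Q0 => q0; rewrite QE q0 mul0r.
have h0 : h != 0 by rewrite -size_poly_gt0 ltnW.
have [|//|e [Q' [Q1E ndv]]] := IH Q1.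
  apply: leq_trans sQ; rewrite QE size_mul //.
  by case: (size h) sh => [|[|k]] // _; rewrite !addnS /= ltnS leq_addr.
by exists e.+1, Q'; split=> //; rewrite QE Q1E exprS mulrC mulrA.
Qed.

(** Recognises a product over conjugates as a power of one irreducible: once all factors [h] are
    removed, a root of the cofactor would be a root of [h], and [h] would divide it again. *)
Lemma irr_power_of_roots (F : fieldType) (L : closedFieldType)
    (iota : {rmorphism F -> L}) (h Q : {poly F}) :
  irreducible_poly h -> Q != 0 ->
  (forall z, root (map_poly iota Q) z -> root (map_poly iota h) z) ->
  exists2 c : F, c != 0 & exists e, Q = c *: h ^+ e.
Proof.
move=> irrh Q0 rQ; have [e [Q' [QE ndv]]] := max_power_factor irrh.1 Q0.
have Q'0 : Q' != 0 by apply: contra_neq Q0 => q0; rewrite QE q0 mulr0.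
have sQ' : size Q' == 1%N.
  apply: contraNT ndv => sQ'.
  have /closed_rootP[z Q'z] : size (map_poly iota Q') != 1%N by rewrite size_map_poly.
  apply: (irr_dvd_common_root irrh (rQ _ _) Q'z).
  by rewrite QE rmorphM rootM Q'z orbT.
have /size_poly1P[c c0 Q'E] := sQ'.
by exists c => //; exists e; rewrite QE Q'E mulrC mul_polyC.
Qed.

Section CharZero.

Variable C : numClosedFieldType.
Local Notation ratC := (map_poly (ratr : rat -> C)).

Lemma irr_rat_roots_uniq (u : {poly rat}) (s : seq C) :
  irreducible_poly u -> ratC u = \prod_(z <- s) ('X - z%:P) -> uniq s.
Proof.
move=> irru us; rewrite -separable_prod_XsubC -us separable_map.
rewrite unlock (irreducible_poly_coprime _ irru).
have u0 : u^`() != 0.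
  apply: contra_neq (irredp_neq0 irru) => /(congr1 (coefp (size u).-2)) /eqP.
  rewrite /= coef_deriv coef0 mulrn_eq0 /= !prednK ?ltn_predRL ?irru.1 //.
  by rewrite -lead_coefE lead_coef_eq0 => /eqP.
by apply/negP => /(dvdp_leq u0); rewrite leqNgt lt_size_deriv // irredp_neq0.
Qed.

Lemma mup_irr_rat_root (h : {poly rat}) (z : C) :
  irreducible_poly h -> root (ratC h) z -> mup z (ratC h) = 1%N.
Proof.
move=> irrh hz.
have h0 : ratC h != 0 by rewrite map_poly_eq0 irredp_neq0.
have [s hs] := closed_field_poly_normal (ratC h).
pose h1 := (lead_coef h)^-1 *: h.
have lh0 : lead_coef h != 0 by rewrite lead_coef_eq0 irredp_neq0.
have irrh1 : irreducible_poly h1.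
  split; first by rewrite size_scale ?invr_eq0 //; exact: irrh.1.
  move=> q sq; rewrite dvdpZr ?invr_eq0 // => /(irrh.2 _ sq) qh.
  by rewrite (eqp_rtrans (eqp_scale _ _)) ?invr_eq0.
have h1s : ratC h1 = \prod_(z <- s) ('X - z%:P).
  by rewrite map_polyZ /= hs scalerA lead_coef_map -rmorphM mulVf // rmorph1 scale1r.
have us := irr_rat_roots_uniq irrh1 h1s.
rewrite hs -mul_polyC mupMr ?rootC ?lead_coef_eq0 // mu_prod_XsubC count_uniq_mem //.
by move: hz; rewrite hs rootZ ?lead_coef_eq0 // root_prod_XsubC => ->.
Qed.

Lemma mup_expn (x : C) (q : {poly C}) e : q != 0 -> mup x (q ^+ e) = (e * mup x q)%N.
Proof.
move=> q0; elim: e => [|e IH]; first by rewrite mupNroot // root1.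
by rewrite exprS mupM ?expf_neq0 // IH mulSn.
Qed.

(** Stands in for an automorphism taking z to w. The roots of [h] are simple, so both multiplicities
    are the exponent of [h] in [Q]. *)
Lemma mup_irr_rat_conj (h Q : {poly rat}) (z w : C) :
  irreducible_poly h -> Q != 0 -> root (ratC h) z -> root (ratC h) w ->
  mup z (ratC Q) = mup w (ratC Q).
Proof.
move=> irrh Q0 hz hw; have [e [Q' [QE ndv]]] := max_power_factor irrh.1 Q0.
have h0 : ratC h != 0 by rewrite map_poly_eq0 irredp_neq0.
have Q'x x : root (ratC h) x -> ~~ root (ratC Q') x.
  by move=> hx; apply: contra ndv; apply: irr_dvd_common_root.
have -> : ratC Q = ratC h ^+ e * ratC Q' by rewrite QE rmorphM rmorphXn.
rewrite (mupMl _ (Q'x z hz)) (mupMl _ (Q'x w hw)).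
by rewrite !(mup_expn _ _ h0) (mup_irr_rat_root irrh hz) (mup_irr_rat_root irrh hw).
Qed.

End CharZero.

(** * An odd number of roots of maximal modulus *)

(* b ^ n * p (a / b) without denominators, when p has degree at most n. *)
Definition homog (A : comNzRingType) (n : nat) (p a b : {poly A}) : {poly A} :=
  \sum_(i < n.+1) p`_i *: (a ^+ i * b ^+ (n - i)).

Lemma homog_prod (A : comNzRingType) (s : seq A) (a b : {poly A}) :
  homog (size s) (\prod_(z <- s) ('X - z%:P)) a b = \prod_(z <- s) (a - z *: b).
Proof.
elim: s => [|z s IH].
  by rewrite /homog big_ord1 !big_nil coef1 !expr0 mulr1 scale1r.
rewrite !big_cons -IH /homog; set q := \prod_(_ <- s) _; set n := size s.
have qn : q`_n.+1 = 0 by rewrite nth_default // size_prod_XsubC.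
rewrite [RHS]mulrBl !mulr_sumr.
transitivity (\sum_(i < n.+2) ((if i == 0%N :> nat then 0 else q`_i.-1)
     *: (a ^+ i * b ^+ (n.+1 - i))) -
   \sum_(i < n.+2) (z * q`_i) *: (a ^+ i * b ^+ (n.+1 - i))).
  rewrite -sumrB; apply: eq_bigr => i _.
  by rewrite mulrBl coefB coefXM coefCM scalerBl.
congr (_ - _).
  rewrite big_ord_recl /= scale0r add0r; apply: eq_bigr => i _.
  by rewrite /= /bump /= add1n subSS exprS -mulrA scalerAr.
rewrite big_ord_recr /= qn mulr0 scale0r addr0; apply: eq_bigr => i _.
rewrite subSn -1?ltnS // exprS mulrCA -scalerAl -scalerAr scalerA.
by rewrite mulrC.
Qed.

Section Boyd.

Variable C : numClosedFieldType.
Local Notation ratC := (map_poly (ratr : rat -> C)).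

Lemma root_rat_conj (f : {poly rat}) (z : C) : root (ratC f) z -> root (ratC f) z^*.
Proof.
have {2}-> : ratC f = map_poly Num.conj (ratC f).
  by rewrite -map_poly_comp; apply: eq_map_poly => x /=; rewrite fmorph_rat.
by rewrite fmorph_root.
Qed.

(** Conjugation exchanges the elements of positive and of negative imaginary part, so the nonreal
    ones are even in number. *)
Lemma odd_conj_closed_real (S : seq C) :
  uniq S -> (forall z, z \in S -> z^* \in S) -> odd (count (fun z => z \is Num.real) S) = odd (size S).
Proof.
move=> uS cS.
have pS : perm_eq [seq z^* | z <- S] S.
  apply: uniq_perm => //; first by rewrite map_inj_uniq //; apply: (can_inj (@conjCK C)).
  move=> z; apply/mapP/idP => [[y yS ->]|zS]; first exact: cS.
  by exists z^*; [exact: cS|rewrite conjCK].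
pose Pp (z : C) := 0 < 'Im z; pose Pm (z : C) := 'Im z < 0.
have cE : count Pm S = count Pp S.
  rewrite -(permP pS Pp) count_map; apply: eq_count => z /=.
  by rewrite /Pp /Pm Im_conj oppr_gt0.
rewrite -(count_predC (fun z => z \is Num.real) S).
have -> : count (predC (fun z => z \is Num.real)) S = (count Pp S + count Pm S)%N.
  rewrite -(@count_predUI _ Pp Pm).
  have -> : count (predI Pp Pm) S = 0%N.
    rewrite (eq_count (a2 := pred0)) ?count_pred0 // => z /=.
    by apply/negP => /andP[]; rewrite /Pp /Pm => /lt_trans H /H; rewrite ltxx.
  rewrite addn0; apply: eq_count => z /=; rewrite /Pp /Pm.
  have -> : (z \is Num.real) = ('Im z == 0) by apply/Creal_ImP/eqP.
  by case: (real_ltgtP (Creal_Im z) (real0 C)).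
by rewrite cE addnn oddD odd_double addbF.
Qed.

Section RealMaxRoot.

Variables (f : {poly rat}) (s : seq C) (r : C).
Hypotheses (mf : f \is monic) (irrf : irreducible_poly f).
Hypothesis fs : ratC f = \prod_(z <- s) ('X - z%:P).
Hypotheses (r_gt0 : 0 < r) (s_le_r : forall z, z \in s -> `|z| <= r).
Let S := [seq z <- s | `|z| == r].
Hypothesis oddS : odd (size S).

Let uniq_s : uniq s. Proof. exact: irr_rat_roots_uniq irrf fs. Qed.
Let uniq_S : uniq S. Proof. exact: filter_uniq. Qed.
Let root_s z : root (ratC f) z = (z \in s). Proof. by rewrite fs root_prod_XsubC. Qed.

Let conj_S z : z \in S -> z^* \in S.
Proof.
rewrite !mem_filter => /andP[zr zs]; rewrite norm_conjC zr -root_s.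
by apply: root_rat_conj; rewrite root_s.
Qed.

Let S_neq0 z : z \in S -> z != 0.
Proof.
by rewrite mem_filter => /andP[/eqP zr _]; rewrite -normr_gt0 zr.
Qed.

(** The real elements of [S] are among r and -r and are odd in number, so exactly one of the two
    occurs. *)
Lemma max_root_real :
  exists x, [/\ x \in S, x \is Num.real & - x \notin S].
Proof.
have := odd_conj_closed_real uniq_S conj_S; rewrite oddS.
set T := [seq z <- S | z \is Num.real]; rewrite -size_filter -/T => oddT.
have uT : uniq T by exact: filter_uniq.
case ET : T oddT uT => [//|x T'] oddT uT.
have xT : x \in T by rewrite ET mem_head.
have /andP[xR xS] : (x \is Num.real) && (x \in S) by rewrite -mem_filter.
exists x; split => //; apply/negP => NxS.
have NxT : - x \in T by rewrite mem_filter rpredN xR.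
have xNx : x != - x by rewrite -addr_eq0 -mulr2n mulrn_eq0 /= S_neq0.
have : perm_eq T [:: x; - x].
  apply: uniq_perm => [|/=|z]; [by rewrite ET|by rewrite inE xNx|].
  apply/idP/idP; last by rewrite !inE => /orP[]/eqP->.
  rewrite mem_filter => /andP[zR]; rewrite mem_filter => /andP[/eqP zr _].
  rewrite !inE -eqf_sqr -(real_normK zR) -(real_normK xR) zr.
  by move: xS; rewrite mem_filter => /andP[/eqP->].
by move/perm_size; rewrite ET => sT'; move: oddT; rewrite sT'.
Qed.

Let s_neq0 : 0 \notin s.
Proof.
apply/negP => s0; have [x [xS _ _]] := max_root_real.
have : f %| 'X.
  by apply: (irr_dvd_common_root (iota := ratr) (z := 0 : C) irrf); rewrite ?root_s // map_polyX rootX.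
rewrite -(dvdp_map (ratr : {rmorphism rat -> C})) => /root_dvdp /(_ (_ : root _ x)).
rewrite root_s map_polyX rootX => x0; have := S_neq0 xS; rewrite x0 //.
by move: xS; rewrite mem_filter => /andP[].
Qed.

Let pair_prod : exists Q : {poly rat},
  ratC Q = \prod_(a <- s) \prod_(b <- s) ('X - (b * a)%:P).
Proof.
(* At a root a, [B] is a ^ n f(X / a) with n = [size s], whose roots are the products b a. *)
pose B : {poly {poly rat}} :=
  \sum_(i < (size s).+1) (f`_i *: 'X^i)%:P * 'X^(size s - i).
have [Q QE] := prod_horner_roots B mf fs uniq_s; exists Q; rewrite QE.
apply: eq_bigr => a _.
transitivity (homog (size s) (ratC f) 'X a%:P).
  rewrite /B /homog rmorph_sum /= horner_sum; apply: eq_bigr => i _.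
  rewrite rmorphM /= map_polyC /= map_polyXn hornerM hornerC hornerXn.
  by rewrite map_polyZ map_polyXn coef_map scalerAl.
rewrite fs homog_prod; apply: eq_bigr => b _.
by rewrite -mul_polyC -polyCM.
Qed.

Let nb_pairs w := count (fun a => w / a \in s) s.

Let mup_pairs w (Q : {poly rat}) :
  ratC Q = \prod_(a <- s) \prod_(b <- s) ('X - (b * a)%:P) ->
  mup w (ratC Q) = nb_pairs w.
Proof.
move=> ->.
have -> : \prod_(a <- s) \prod_(b <- s) ('X - (b * a)%:P) =
   \prod_(z <- [seq b * a | a <- s, b <- s]) ('X - z%:P).
  by rewrite big_allpairs_dep.
rewrite mu_prod_XsubC count_flatten -map_comp /nb_pairs -sum1_count.
rewrite [RHS]big_mkcond /= sumnE big_map big_seq [RHS]big_seq.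
apply: eq_bigr => a sa /=.
have a0 : a != 0 by apply: contraNneq s_neq0 => <-.
rewrite count_map -[if _ then _ else _]/(nat_of_bool (w / a \in s)) -count_uniq_mem //.
by apply: eq_count => b /=; rewrite -[RHS](inj_eq (mulIf a0)) divfK.
Qed.

Let pow_roots k : exists P : {poly rat},
  ratC P = \prod_(a <- s) ('X - (a ^+ k)%:P).
Proof.
have [P PE] := prod_horner_roots ('X%:P - 'X^k) mf fs uniq_s; exists P; rewrite PE.
apply: eq_bigr => a _.
by rewrite rmorphB /= map_polyC /= map_polyX map_polyXn !hornerE polyC_exp.
Qed.

(** With h the minimal polynomial of a ^ m, h(X ^ m) vanishes at a, hence is divisible by f: the
    m-th powers of the roots of f are all conjugate. *)
Let minpoly_pow m a : a \in s -> exists h : {poly rat},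
  [/\ h \is monic, irreducible_poly h, root (ratC h) (a ^+ m) &
     forall b, b \in s -> root (ratC h) (b ^+ m)].
Proof.
move=> sa; have [P PE] := pow_roots m.
have P0 : P != 0.
  rewrite -(map_poly_eq0 (ratr : {rmorphism rat -> C})) PE.
  by rewrite prodf_seq_neq0; apply/allP => y _; rewrite polyXsubC_eq0.
have Pa : root (ratC P) (a ^+ m).
  have -> : ratC P = \prod_(z <- [seq a ^+ m | a <- s]) ('X - z%:P) by rewrite big_map.
  by rewrite root_prod_XsubC; apply/mapP; exists a.
have [h [mh irrh ha]] := irr_root_minimal P0 Pa; exists h; split=> // b sb.
have compE z : root (ratC (h \Po 'X^m)) z = root (ratC h) (z ^+ m).
  by rewrite map_comp_poly /= map_polyXn /root horner_comp hornerXn.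
rewrite -compE; have : f %| h \Po 'X^m.
  by apply: (irr_dvd_common_root (iota := ratr) (z := a) irrf); rewrite ?root_s ?compE.
rewrite -(dvdp_map (ratr : {rmorphism rat -> C})) => /root_dvdp; apply.
by rewrite root_s.
Qed.

(* Both sides are multiplicities, in the rational polynomial whose roots are all
   the products of two roots of f, of conjugate algebraic numbers. *)
Let nb_pairs_sqr a b : a \in s -> b \in s -> nb_pairs (a ^+ 2) = nb_pairs (b ^+ 2).
Proof.
move=> sa sb; have [Q QE] := pair_prod.
have Q0 : Q != 0.
  rewrite -(map_poly_eq0 (ratr : {rmorphism rat -> C})) QE.
  rewrite prodf_seq_neq0; apply/allP => x _; rewrite prodf_seq_neq0; apply/allP => y _.
  by rewrite polyXsubC_eq0.
rewrite -!(mup_pairs _ QE).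
have [h [mh irrh ha hb]] := minpoly_pow 2 sa.
exact: (mup_irr_rat_conj irrh Q0 ha (hb _ sb)).
Qed.

Let S_r z : (z \in S) = (z \in s) && (`|z| == r).
Proof. by rewrite mem_filter andbC. Qed.

(* Every a in S satisfies a * a^* = x ^ 2 for the real root x in S, so x ^ 2 has
   at least #|S| factorisations into two roots, hence so does c ^ 2 for c in S;
   as their factors lie in S, all elements of S occur. *)
Let S_sqr_div a b : a \in S -> b \in S -> a ^+ 2 / b \in S.
Proof.
have [x [xS xR NxS]] := max_root_real.
have x2 : x ^+ 2 = r ^+ 2.
  by rewrite -(real_normK xR); move: xS; rewrite S_r => /andP[_ /eqP->].
(* The moduli of c ^ 2 / d and d are at most r and their product is r ^ 2, so both equal r. *)
have pairS c : c \in S -> predI (fun d => c ^+ 2 / d \in s) (mem s) =1 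
    predI (fun d => c ^+ 2 / d \in s) (mem S).
  rewrite S_r => /andP[cs /eqP cr] d /=; rewrite S_r.
  case: (boolP (_ \in s)) => //= cds; case: (boolP (d \in s)) => //= ds.
  apply/esym; rewrite eq_le s_le_r //=.
  have d0 : 0 < `|d| by rewrite normr_gt0; apply: contraNneq s_neq0 => <-.
  have := s_le_r cds; rewrite normrM normfV normrX cr ler_pdivrMr //.
  by rewrite expr2 ler_pM2l.
have countS c : c \in S -> nb_pairs (c ^+ 2) = count (fun d => c ^+ 2 / d \in s) S.
  move=> cS; rewrite /nb_pairs count_filter.
  apply: eq_in_count => d ds; have /= := pairS c cS d; rewrite !S_r ds !andbT => ->.
  by rewrite andTb -andbA andbb.
have xall : count (fun d => x ^+ 2 / d \in s) S = size S.
  apply/eqP; rewrite -all_count; apply/allP => d dS /=.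
  suff -> : x ^+ 2 / d = d^* by have := conj_S dS; rewrite S_r => /andP[].
  rewrite x2; move: (dS); rewrite S_r => /andP[_ /eqP <-].
  by rewrite normCK mulrAC divff ?mul1r ?S_neq0.
move=> aS bS.
have : all (fun d => a ^+ 2 / d \in s) S.
  rewrite all_count -countS // -xall -countS //; apply/eqP.
  by apply: nb_pairs_sqr; [move: aS|move: xS]; rewrite S_r => /andP[].
move/allP/(_ b bS) => /= abs; rewrite S_r abs normrM normfV normrX.
move: aS bS; rewrite !S_r => /andP[_ /eqP->] /andP[_ /eqP->].
by rewrite expr2 mulfK ?eqxx ?gt_eqF.
Qed.

(* The bijection b |-> a ^ 2 / b of S gives a ^ (2k) = (\prod S) ^ 2 for all a in
   S, hence a ^ k = +- x ^ k; the minus sign would put x (a / x) ^ k = - x in S. *)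
Let S_pow x a : x \in S -> x \is Num.real -> - x \notin S -> a \in S ->
  a ^+ (size S) = x ^+ (size S).
Proof.
move=> xS xR NxS aS; set k := size S.
have x0 := S_neq0 xS; have a0 := S_neq0 aS.
have sqS c : c \in S -> c ^+ (2 * k) = (\prod_(b <- S) b) ^+ 2.
  move=> cS; have c0 := S_neq0 cS.
  have injc : injective (fun b => c ^+ 2 / b).
    by move=> b b' /(mulfI (expf_neq0 2 c0)) /invr_inj.
  have pS : perm_eq [seq c ^+ 2 / b | b <- S] S.
    have [|||szs eqs] := @uniq_min_size _ [seq c ^+ 2 / b | b <- S] S.
    - by rewrite map_inj_uniq.
    - by move=> _ /mapP[b bS ->]; apply: S_sqr_div.
    - by rewrite size_map.
    by apply: uniq_perm => //; rewrite map_inj_uniq.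
  have PN0 : \prod_(b <- S) b != 0.
    by rewrite prodf_seq_neq0; apply/allP => b /S_neq0.
  have : \prod_(b <- [seq c ^+ 2 / b | b <- S]) b = \prod_(b <- S) b by apply: perm_big.
  rewrite big_map big_split /= prodfV big_const_seq count_predT iter_mulr_1 -exprM -/k.
  by move/(canRL (mulfVK PN0)); rewrite expr2.
have : (a ^+ k) ^+ 2 == (x ^+ k) ^+ 2.
  by rewrite -!exprM ![(k * 2)%N]mulnC !sqS.
rewrite eqf_sqr => /orP[/eqP//|/eqP akx].
(* The reflections b |-> x ^ 2 / b and b |-> a ^ 2 / b compose to multiplication by (a / x) ^ 2.
   Applied (k - 1) / 2 times to a, this gives x (a / x) ^ k = - x. *)
have powS j : a * (a / x) ^+ (2 * j) \in S.
  elim: j => [|j IH]; first by rewrite mulr1.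
  have := S_sqr_div aS (S_sqr_div xS IH).
  congr (_ \in S); rewrite mulnS exprD; set y := (a / x) ^+ (2 * j).
  have y0 : y != 0 by rewrite expf_neq0 // mulf_neq0 ?invr_neq0.
  by field; rewrite y0 ?x0 ?a0.
have := powS k./2; have kE : k = (k./2 * 2).+1.
  by rewrite -[LHS]odd_double_half -/k oddS add1n -muln2.
suff -> : a * (a / x) ^+ (2 * k./2) = - x by rewrite (negbTE NxS).
have -> : a * (a / x) ^+ (2 * k./2) = x * (a / x) ^+ k.
  by rewrite [in RHS]kE exprS mulrA [x * _]mulrC divfK // mulnC.
by rewrite expr_div_n akx mulNr divff ?expf_neq0 // mulrN1.
Qed.

(* Theorem of Ferguson and Boyd. The multiplicity of x ^ k in \prod (X - a ^ k),
   which is a power of the minimal polynomial of x ^ k, is exactly k. *)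
Lemma odd_max_roots_comp : exists2 h : {poly rat},
  h \is monic & f = h \Po 'X^(size S).
Proof.
have [x [xS xR NxS]] := max_root_real; set k := size S.
have xs : x \in s by move: xS; rewrite S_r => /andP[].
have k0 : (0 < k)%N by rewrite /k; case: (S) xS.
have [P PE] := pow_roots k.
have [h [mh irrh hx hs]] := minpoly_pow k xs.
have P0 : P != 0.
  rewrite -(map_poly_eq0 (ratr : {rmorphism rat -> C})) PE.
  by rewrite prodf_seq_neq0; apply/allP => y _; rewrite polyXsubC_eq0.
have PE' : ratC P = \prod_(z <- [seq a ^+ k | a <- s]) ('X - z%:P) by rewrite big_map.
have [|c c0 [e Pe]] := irr_power_of_roots (iota := ratr) irrh P0 (L := C).
  by move=> z; rewrite PE' root_prod_XsubC => /mapP[a sa ->]; exact: hs.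
have h0 : ratC h != 0 by rewrite map_poly_eq0 irredp_neq0.
have ek : e = k.
  have := congr1 (fun q => mup (x ^+ k) (ratC q)) Pe.
  rewrite PE' mu_prod_XsubC.
  have -> : ratC (c *: h ^+ e) = (ratr c)%:P * ratC h ^+ e.
    by rewrite map_polyZ /= rmorphXn mul_polyC.
  rewrite mupMr ?rootC ?fmorph_eq0 // (mup_expn _ _ h0) (mup_irr_rat_root irrh hx).
  rewrite muln1 => <-; rewrite count_map.
  transitivity (count (fun z => `|z| == r) s); last by rewrite /k size_filter.
  apply: eq_in_count => a sa /=.
  have xr : `|x| = r by move: xS; rewrite S_r => /andP[_ /eqP].
  apply/eqP/eqP => [axk|ar]; last by apply: S_pow; rewrite // S_r sa ar eqxx.
  apply/eqP; rewrite -(eqrXn2 k0 (normr_ge0 a) (ltW r_gt0)).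
  by rewrite -normrX axk normrX xr.
exists h => //; apply/eqP; rewrite -eqp_monic //; last first.
  by rewrite monicE lead_coef_comp ?size_polyXn // lead_coefXn expr1n mulr1.
(* f divides h(X ^ k) because both vanish at x; the degrees agree because P = c h ^ k has as many
   roots as f. *)
rewrite -dvdp_size_eqp; last first.
  apply: (irr_dvd_common_root (iota := ratr) (z := x) irrf); rewrite ?root_s //.
  by rewrite map_comp_poly /= map_polyXn /root horner_comp hornerXn.
have sf : size f = (size s).+1 by rewrite -(size_map_poly (ratr : {rmorphism rat -> C})) fs size_prod_XsubC.
have sP : size P = (size s).+1.
  by rewrite -(size_map_poly (ratr : {rmorphism rat -> C})) PE' size_prod_XsubC size_map.
have sh0 : (0 < size h)%N by rewrite size_poly_gt0 irredp_neq0.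
have : (size P).-1 = ((size h).-1 * k)%N by rewrite Pe size_scale // size_exp ek.
rewrite sP /= sf => ->.
have := size_comp_poly h 'X^k; rewrite size_polyXn /= => <-.
rewrite prednK // size_poly_gt0 -lead_coef_eq0 lead_coef_comp ?size_polyXn //.
by rewrite lead_coefXn expr1n mulr1 lead_coef_eq0 irredp_neq0.
Qed.

End RealMaxRoot.
End Boyd.

(** * Irreducibility criteria *)

(** Gauss's lemma. The integral divisor has leading coefficient 1 or -1, its own inverse; scaling
    both factors by it keeps the product and makes the first factor monic. *)
Lemma monic_rat_dvd_int (u : {poly rat}) (f : {poly int}) :
  u \is monic -> f \is monic -> u %| pZtoQ f ->
  exists v w : {poly int}, [/\ v \is monic, u = pZtoQ v & f = v * w].
Proof.
move=> mu mf /dvdpP_rat_int[p [a a0 uE] [r fE]].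
have lpr : lead_coef p * lead_coef r = 1 by rewrite -lead_coefM -fE (eqP mf).
have lp2 : lead_coef p * lead_coef p = 1.
  have /eqP := congr1 absz lpr; rewrite abszM muln_eq1 => /andP[/eqP l1 _].
  by rewrite -expr2 -(real_normK (num_real _)) -abszE l1.
exists (lead_coef p *: p), (lead_coef p *: r); split.
- by rewrite monicE lead_coefZ lp2.
- rewrite uE map_polyZ /=; congr (_ *: _).
  have := mu; rewrite monicE uE lead_coefZ lead_coef_map_inj //; last exact: intr_inj.
  move=> /eqP al; apply: (mulIf (x := (lead_coef p)%:~R)).
    by rewrite intr_eq0; apply: contra_eq_neq lp2 => ->.
  by rewrite al -intrM lp2.
- by rewrite -scalerAl -scalerAr scalerA lp2 scale1r.
Qed.

(** With x e = y d + 1, G = (A ^ x / G ^ y) ^ d; the quotient is an integer because divisibility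
    between d-th powers descends to their bases. *)
Lemma coprime_perfect_power (A G d e : nat) :
  (0 < d)%N -> (0 < e)%N -> coprime d e -> (A ^ d = G ^ e)%N -> exists y, (G = y ^ d)%N.
Proof.
move=> d0 e0 cde AG; have [->|G0] := posnP G; first by exists 0%N; rewrite exp0n.
case: (egcdnP d e0) => x y; rewrite gcdnC (eqP cde) => xy _.
have E : ((A ^ x) ^ d = G * (G ^ y) ^ d)%N.
  by rewrite -!expnM -expnS [(x * d)%N]mulnC expnM AG -expnM mulnC xy addn1.
have : ((G ^ y) ^ d %| (A ^ x) ^ d)%N by rewrite E dvdn_mull.
rewrite dvdn_pexp2r // => /dvdnP[z zE]; exists z.
apply/eqP; rewrite -(eqn_pmul2r (m := ((G ^ y) ^ d)%N)) ?expn_gt0 ?G0 //.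
by rewrite -E zE expnMn.
Qed.

Lemma perfect_power_gcd (A G k e : nat) :
  (0 < k)%N -> (0 < e)%N -> (A ^ k = G ^ e)%N -> exists y, (G = y ^ (k %/ gcdn k e))%N.
Proof.
move=> k0 e0 AG; have g0 : (0 < gcdn k e)%N by rewrite gcdn_gt0 k0.
apply: (@coprime_perfect_power A G _ (e %/ gcdn k e)).
- by rewrite divn_gt0 // dvdn_leq // dvdn_gcdl.
- by rewrite divn_gt0 // dvdn_leq // dvdn_gcdr.
- rewrite /coprime -(eqn_pmul2r g0) muln_gcdl !divnK ?dvdn_gcdl ?dvdn_gcdr //.
  by rewrite mul1n.
- apply/eqP; rewrite -(eqn_exp2r _ _ g0) -!expnM !divnK ?dvdn_gcdl ?dvdn_gcdr //.
  exact/eqP.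
Qed.

Lemma irr_monic_dvd_eq (F : fieldType) (u f : {poly F}) :
  u \is monic -> f \is monic -> u %| f -> (size f <= size u)%N -> u = f.
Proof.
move=> mu mf uf sfu; apply/eqP; rewrite -eqp_monic // -dvdp_size_eqp //.
by rewrite eqn_leq dvdp_leq // monic_neq0.
Qed.

Lemma monic_comp_polyXn (A : idomainType) (g : {poly A}) k :
  (0 < k)%N -> g \is monic -> g \Po 'X^k \is monic.
Proof.
move=> k0 mg; rewrite monicE lead_coef_comp ?size_polyXn //.
by rewrite (eqP mg) lead_coefXn expr1n mulr1.
Qed.

(* If u of degree e * deg g is the minimal polynomial of a root of g(X ^ k), then
   \prod_(u(a) = 0) (X - a ^ k) = g ^ e, whence u(0) ^ k = +- g(0) ^ e. *)
Lemma irr_comp_polyXn (gz : {poly int}) (k : nat) :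
  (0 < k)%N -> gz \is monic -> irreducible_poly (pZtoQ gz) ->
  (forall y d : nat, (1 < d <= k)%N -> absz gz`_0 <> (y ^ d)%N) ->
  irreducible_poly (pZtoQ (gz \Po 'X^k)).
Proof.
move=> k0 mgz irrg npow; set g := pZtoQ gz in irrg *.
pose f := g \Po 'X^k.
have -> : pZtoQ (gz \Po 'X^k) = f by rewrite map_comp_poly /= map_polyXn.
have mg : g \is monic by exact: monic_map.
have mf : f \is monic by exact: monic_comp_polyXn.
have sf : (size f).-1 = ((size g).-1 * k)%N by rewrite size_comp_poly size_polyXn.
have sg := irrg.1.
pose ratC := map_poly (ratr : rat -> algC).
have compE z : root (ratC f) z = root (ratC g) (z ^+ k).
  by rewrite /ratC map_comp_poly /= map_polyXn /root horner_comp hornerXn.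
have /closed_rootP[z fz] : size (ratC f) != 1%N.
  rewrite size_map_poly; apply: contraTneq k0 => sf1; move: sf; rewrite sf1 /=.
  by case: (size g) sg => [|[|n]] // _ /esym/eqP; rewrite muln_eq0 /= => /eqP->.
have f0 : f != 0 by exact: monic_neq0.
have [u [mu irru uz]] := irr_root_minimal f0 fz.
have uf : u %| f by exact: (irr_dvd_common_root irru uz fz).
have [s us] := closed_field_poly_normal (ratC u).
have {}us : ratC u = \prod_(a <- s) ('X - a%:P).
  by rewrite us lead_coef_map (eqP mu) rmorph1 scale1r.
have uniqs := irr_rat_roots_uniq irru us.
have su : size u = (size s).+1.
  by rewrite -(size_map_poly (ratr : {rmorphism rat -> algC})) [map_poly _ _]us size_prod_XsubC.
have [P PE] := prod_horner_roots ('X%:P - 'X^k) mu us uniqs.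
have {}PE : ratC P = \prod_(a <- [seq a ^+ k | a <- s]) ('X - a%:P).
  rewrite [LHS]PE big_map; apply: eq_bigr => a _.
  by rewrite rmorphB /= map_polyC /= map_polyX map_polyXn !hornerE polyC_exp.
have mP : P \is monic.
  by rewrite -(map_monic (ratr : {rmorphism rat -> algC})) [map_poly _ _]PE monic_prod_XsubC.
have [|c c0 [e Pe]] := irr_power_of_roots (iota := ratr) irrg (monic_neq0 mP) (L := algC).
  move=> w; rewrite [map_poly _ _]PE root_prod_XsubC => /mapP[a sa ->].
  rewrite -compE; apply: (@root_dvdp _ (ratC u)); first by rewrite dvdp_map.
  by rewrite us root_prod_XsubC.
have {c0}Pe : P = g ^+ e.
  have := mP; rewrite Pe monicE lead_coefZ (monicP (monic_exp e mg)) mulr1 => /eqP->.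
  by rewrite scale1r.
have se : (size s = (size g).-1 * e)%N.
  have := congr1 (fun q : {poly rat} => (size q).-1) Pe.
  rewrite size_exp -(size_map_poly (ratr : {rmorphism rat -> algC})) [map_poly _ _]PE.
  by rewrite size_prod_XsubC size_map.
have [v [w [mv uv _]]] : exists v w : {poly int},
    [/\ v \is monic, u = pZtoQ v & gz \Po 'X^k = v * w].
  apply: monic_rat_dvd_int => //; first exact: monic_comp_polyXn.
  by rewrite map_comp_poly /= map_polyXn.
have e0 : (0 < e)%N.
  by rewrite lt0n; apply: contraTneq irru.1 => e0; rewrite su se e0 muln0.
have norm0 : (absz (v`_0)%R ^ k = absz (gz`_0)%R ^ e)%N.
  have abs_prod (t : seq algC) : `|(\prod_(a <- t) ('X - a%:P))`_0| = \prod_(a <- t) `|a|.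
    elim: t => [|a t IH]; first by rewrite !big_nil coef1 normr1.
    by rewrite !big_cons coef0M normrM IH coefB coefX coefC sub0r normrN.
  have absC (p : {poly int}) : `|(ratC (pZtoQ p))`_0| = (absz p`_0)%:R :> algC.
    by rewrite !coef_map /= ratr_int -intr_norm -abszE.
  have coef0X (p : {poly algC}) j : (p ^+ j)`_0 = p`_0 ^+ j.
    by rewrite -!horner_coef0 horner_exp.
  have : `|(ratC u)`_0| ^+ k = `|(ratC P)`_0|.
    by rewrite us PE !abs_prod big_map -prodrXl; apply: eq_bigr => a _; rewrite normrX.
  rewrite uv absC Pe /ratC rmorphXn /= coef0X normrX absC -!natrX => /eqP.
  by rewrite eqr_nat => /eqP.
(* Were e < k, |g(0)| would be a power of exponent k / gcd(k, e) > 1. Once k <= e, the degree e deg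
   g of [u] is at least that of [f]. *)
have ke : (k <= e)%N.
  have [y yE] := perfect_power_gcd k0 e0 norm0.
  rewrite leqNgt; apply/negP => ek; apply: (npow y (k %/ gcdn k e)%N) => //.
  have g0 : (0 < gcdn k e)%N by rewrite gcdn_gt0 k0.
  rewrite leq_div andbT ltnNge -(leq_pmul2r g0) mul1n divnK ?dvdn_gcdl // -ltnNge.
  by apply: leq_ltn_trans ek; rewrite dvdn_leq // dvdn_gcdr.
suff <- : u = f by [].
apply: irr_monic_dvd_eq => //; rewrite su se -(prednK (n := size f)) ?size_poly_gt0 //.
by rewrite sf ltnS leq_mul2l ke orbT.
Qed.

(** * Irreducibility of X ^ m g(X + rho / X) *)

Section SelfInversive.

Variable C : numClosedFieldType.
Local Notation ratC := (map_poly (ratr : rat -> C)).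

Lemma map_homog (A B : comNzRingType) (phi : {rmorphism A -> B}) n (p a b : {poly A}) :
  map_poly phi (homog n p a b) = homog n (map_poly phi p) (map_poly phi a) (map_poly phi b).
Proof.
rewrite /homog rmorph_sum; apply: eq_bigr => i _.
by rewrite /= map_polyZ rmorphM /= !rmorphXn /= coef_map.
Qed.

Lemma prod_quadratic (A : idomainType) (t : seq A) (rho : A) :
  (\prod_(c <- t) ('X^2 + rho%:P - c *: 'X) \is monic) /\
  size (\prod_(c <- t) ('X^2 + rho%:P - c *: 'X)) = (size t).*2.+1.
Proof.
have sq (c : A) : size ('X^2 + rho%:P - c *: 'X) = 3%N /\ 'X^2 + rho%:P - c *: 'X \is monic.
  have -> : 'X^2 + rho%:P - c *: 'X = 'X^2 + (rho%:P - c *: 'X) :> {poly A} by rewrite addrA.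
  have sr : (size (rho%:P - c *: 'X)%R < size ('X^2 : {poly A}))%N.
    rewrite size_polyXn ltnS (leq_trans (size_polyD _ _)) // size_polyN geq_max.
    rewrite (leq_trans (size_polyC_leq1 _)) //=.
    by rewrite (leq_trans (size_scale_leq _ _)) ?size_polyX.
  by rewrite size_polyDl // size_polyXn monicE lead_coefDl // lead_coefXn.
elim: t => [|c t [IHm IHs]]; first by rewrite big_nil monic1 size_poly1.
rewrite big_cons; have [s3 mq] := sq c; rewrite monicMl //; split=> //.
by rewrite size_monicM ?monic_neq0 // s3 IHs addnS.
Qed.

Lemma quadratic_root_nonreal (c rho z : C) :
  c \is Num.real -> c ^+ 2 < 4 * rho -> z ^+ 2 + rho = c * z -> z != z^*.
Proof.
move=> cr c2 E; apply/negP => /eqP zc; have zr : z \is Num.real by apply/CrealP.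
have : (2 * z - c) ^+ 2 < 0.
  have -> : (2 * z - c) ^+ 2 = c ^+ 2 - 4 * rho.
    have -> : rho = c * z - z ^+ 2 by rewrite -E addrC addKr.
    by ring.
  by rewrite subr_lt0.
have wr : 2 * z - c \is Num.real by rewrite rpredB // rpredM // realn.
rewrite -(real_normK wr) => /(le_lt_trans (exprn_ge0 2 (normr_ge0 _))).
by rewrite ltxx.
Qed.

(** As c and rho are real, z and its conjugate are the two distinct roots of X ^ 2 - c X + rho,
    whose product is rho. *)
Lemma quadratic_root_norm (c rho z : C) :
  c \is Num.real -> c ^+ 2 < 4 * rho -> rho \is Num.real ->
  z ^+ 2 + rho = c * z -> `|z| ^+ 2 = rho.
Proof.
move=> cr c2 rr E; have zz := quadratic_root_nonreal cr c2 E.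
have Ec : z^* ^+ 2 + rho = c * z^*.
  by rewrite -{1}(CrealP rr) -{1}(CrealP cr) -rmorphXn -rmorphD /= E rmorphM.
have : (z - z^*) * (z + z^* - c) = 0.
  have -> : (z - z^*) * (z + z^* - c) = (z ^+ 2 + rho - c * z) - (z^* ^+ 2 + rho - c * z^*) by ring.
  by rewrite E Ec !subrr.
move/eqP; rewrite mulf_eq0 !subr_eq0 (negbTE zz) /= => /eqP zc.
rewrite normCK -[RHS](addKr (z ^+ 2)) E -zc; ring.
Qed.

(* For a minimal polynomial u of a root, the product over its roots a of
   a X - a ^ 2 - rho = a (X - (a + rho / a)) is c g ^ e; a root and its complex
   conjugate give the same a + rho / a, so e >= 2. *)
Lemma irr_self_inversive (m : nat) (g : {poly rat}) (rho : rat) (t : seq C) :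
  g \is monic -> irreducible_poly g -> size g = m.+1 ->
  ratC g = \prod_(c <- t) ('X - c%:P) ->
  (forall c, c \in t -> c \is Num.real /\ c ^+ 2 < 4 * ratr rho) ->
  irreducible_poly (homog m g ('X^2 + rho%:P) 'X).
Proof.
move=> mg irrg sg gt treal; set f := homog _ _ _ _.
have szt : size t = m.
  by have := congr1 (size \o val) gt; rewrite /= size_prod_XsubC size_map_poly sg => -[].
have fC : ratC f = \prod_(c <- t) ('X^2 + (ratr rho)%:P - c *: 'X).
  rewrite map_homog /= [map_poly _ g]gt -szt -homog_prod.
  by rewrite rmorphD /= map_polyXn map_polyC map_polyX.
have [mfC sfC] := prod_quadratic t (ratr rho : C); rewrite -fC szt in mfC sfC.
have mf : f \is monic by rewrite -(map_monic (ratr : {rmorphism rat -> C})).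
have sf : size f = m.*2.+1 by rewrite -sfC size_map_poly.
have rootf z : reflect (exists2 c, c \in t & z ^+ 2 + ratr rho = c * z) (root (ratC f) z).
  rewrite fC /root horner_prod prodf_seq_eq0.
  apply: (iffP hasP) => -[c tc zc]; exists c => //; move: zc => /=.
    by rewrite !hornerE subr_eq0 => /eqP.
  by move=> zc; rewrite !hornerE subr_eq0 zc.
have m0 : (0 < m)%N by move: irrg.1; rewrite sg.
have rho0 : 0 < ratr rho :> C.
  case: (t) szt treal m0 => [<-//|c t' _ /(_ c (mem_head _ _))[cr c2] _].
  rewrite -(pmulr_rgt0 (x := 4)) // (le_lt_trans _ c2) //.
  by rewrite -(real_normK cr) exprn_ge0.
have rootf_neq0 z : root (ratC f) z -> z != 0.
  move/rootf => [c _]; apply: contra_eq_neq => ->.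
  by rewrite expr0n mulr0 add0r gt_eqF.
have rootf_conj z : root (ratC f) z -> z != z^*.
  by move/rootf => [c /treal[cr c2]]; apply: quadratic_root_nonreal.
have /closed_rootP[z fz] : size (ratC f) != 1%N by rewrite sfC; case: (m) m0.
have [u [mu irru uz]] := irr_root_minimal (monic_neq0 mf) fz.
have uf : u %| f by exact: (irr_dvd_common_root irru uz fz).
have [s us] := closed_field_poly_normal (ratC u).
have {}us : ratC u = \prod_(a <- s) ('X - a%:P).
  by rewrite us lead_coef_map (eqP mu) rmorph1 scale1r.
have uniqs := irr_rat_roots_uniq irru us.
have rootu a : root (ratC u) a = (a \in s) by rewrite us root_prod_XsubC.
have su : size u = (size s).+1.
  by rewrite -(size_map_poly (ratr : {rmorphism rat -> C})) [map_poly _ _]us size_prod_XsubC.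
have sfr a : a \in s -> root (ratC f) a.
  by rewrite -rootu; apply: root_dvdp; rewrite dvdp_map.
pose gam (a : C) := (a ^+ 2 + ratr rho) / a.
have gamt a : a \in s -> gam a \in t.
  move=> sa; have a0 := rootf_neq0 _ (sfr _ sa).
  by have /rootf[c ct E] := sfr _ sa; rewrite /gam E mulfK.
have [P PE] := prod_horner_roots ('X%:P * 'X - 'X^2 - rho%:P%:P) mu us uniqs.
have {}PE : ratC P = \prod_(a <- s) (a *: ('X - (gam a)%:P)).
  rewrite [LHS]PE [LHS]big_seq [RHS]big_seq; apply: eq_bigr => a sa.
  rewrite !rmorphB /= rmorphM /= !map_polyC /= !map_polyC /= !map_polyX map_polyXn !hornerE.
  have a0 := rootf_neq0 _ (sfr _ sa).
  rewrite scalerBr -mul_polyC -mul_polyC -polyCM /gam mulrCA divff // mulr1.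
  by rewrite polyCD polyC_exp opprD addrA mulrC.
have {}PE : ratC P = (\prod_(a <- s) a) *: \prod_(c <- map gam s) ('X - c%:P).
  by rewrite PE big_map scaler_prod.
have pN0 : \prod_(a <- s) a != 0.
  by rewrite prodf_seq_neq0; apply/allP => a /sfr /rootf_neq0.
have P0 : P != 0.
  rewrite -(map_poly_eq0 (ratr : {rmorphism rat -> C})) [map_poly _ _]PE.
  by rewrite scaler_eq0 negb_or pN0 monic_neq0 // monic_prod_XsubC.
have [|c c0 [e Pe]] := irr_power_of_roots (iota := ratr) irrg P0 (L := C).
  move=> w; rewrite [map_poly _ _]PE rootZ // root_prod_XsubC => /mapP[a sa ->].
  by rewrite [map_poly _ _]gt root_prod_XsubC; exact: gamt.
have se : (size s = m * e)%N.
  have := congr1 (fun q : {poly rat} => (size q).-1) Pe.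
  rewrite size_scale // size_exp sg.
  rewrite -(size_map_poly (ratr : {rmorphism rat -> C})) [map_poly _ _]PE size_scale //.
  by rewrite size_prod_XsubC size_map.
have zs : z \in s by rewrite -rootu.
have zcs : z^* \in s by rewrite -rootu; apply: root_rat_conj; rewrite rootu.
have e2 : (2 <= e)%N.
  have hz : root (ratC g) (gam z) by rewrite gt root_prod_XsubC gamt.
  have g0 : ratC g != 0 by rewrite map_poly_eq0 irredp_neq0.
  have <- : mup (gam z) (ratC P) = e.
    have -> : ratC P = (ratr c)%:P * ratC g ^+ e.
      by rewrite Pe map_polyZ /= rmorphXn mul_polyC.
    by rewrite mupMr ?rootC ?fmorph_eq0 // (mup_expn _ _ g0) (mup_irr_rat_root irrg hz) muln1.
  rewrite PE -mul_polyC mupMr ?rootC // mu_prod_XsubC count_map.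
  have gzc : gam z^* = gam z.
    have [gr _] := treal _ (gamt _ zs).
    rewrite -[RHS](CrealP gr) /gam rmorphM /= fmorphV rmorphD rmorphXn /=.
    by rewrite fmorph_rat.
  have : perm_eq s (z :: rem z s) by exact: perm_to_rem.
  move=> /permP->; rewrite /= eqxx add1n ltnS -has_count; apply/hasP.
  exists z^*; last by rewrite /= gzc.
  by rewrite mem_rem_uniq // inE zcs andbT eq_sym rootf_conj.
suff <- : u = f by [].
apply: irr_monic_dvd_eq => //.
by rewrite su se sf ltnS -mul2n mulnC leq_mul2l e2 orbT.
Qed.

End SelfInversive.

(** * Coefficients and moduli of roots *)

Section Landau.

Variable C : numClosedFieldType.

(** For each index i the cross terms of both squared moduli agree, and what remains is a fixed
    multiple of |q_(i-1)| ^ 2 - |q_i| ^ 2, so the difference of the sums telescopes. *)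
Lemma norm2_reflect (q : {poly C}) (z : C) n : (size q <= n)%N ->
  \sum_(i < n.+1) `|((z^* *: 'X - 1) * q)`_i| ^+ 2 =
  \sum_(i < n.+1) `|(('X - z%:P) * q)`_i| ^+ 2.
Proof.
move=> sq; apply/eqP; rewrite eq_sym -subr_eq0 -sumrB.
pose b (i : nat) : C := if i is j.+1 then `|q`_j| ^+ 2 else 0.
rewrite (eq_bigr (fun i : 'I_n.+1 => (1 - `|z| ^+ 2) * - (b i.+1 - b i))); last first.
  move=> i _; rewrite !(mulrBl q) !coefB -(scalerAl _ 'X q) mul1r coefZ !coefXM coefCM.
  case: i => [[|i] ilt] /=; first by rewrite mulr0 !sub0r !normrN normrM exprMn; ring.
  rewrite !normCK !rmorphB !rmorphM /= conjCK; ring.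
rewrite -mulr_sumr sumrN -(big_mkord xpredT (fun i => b i.+1 - b i)) telescope_sumr //.
by rewrite /b nth_default // normr0 expr0n subr0 oppr0 mulr0.
Qed.

Lemma norm2_prod_reflect (s : seq C) (q : {poly C}) n : (size s + size q <= n)%N ->
  \sum_(i < n) `|(\prod_(z <- s) ('X - z%:P) * q)`_i| ^+ 2 =
  \sum_(i < n) `|(\prod_(z <- s) (z^* *: 'X - 1) * q)`_i| ^+ 2.
Proof.
elim: s q => [|z s IH] q; first by rewrite !big_nil.
case: n IH => // n IH; rewrite /= addSn ltnS => sq; rewrite !big_cons -!mulrA.
rewrite -norm2_reflect; last first.
  by rewrite (leq_trans (size_polyMleq _ _)) // size_prod_XsubC.
rewrite mulrCA IH; first by apply: eq_bigr => i _; rewrite mulrCA.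
apply: (@leq_trans (size s + (size q).+1)); last by rewrite addnS ltnS.
rewrite leq_add2l (leq_trans (size_polyMleq _ _)) //.
have szl : (size (z^* *: 'X - 1 : {poly C})%R <= 2)%N.
  rewrite (leq_trans (size_polyD _ _)) // size_polyN size_poly1 geq_max andbT.
  by rewrite (leq_trans (size_scale_leq _ _)) // size_polyX.
by rewrite -subn1 leq_subLR add1n -(add2n (size q)) leq_add2r.
Qed.

Lemma prod_reflect_top (s : seq C) (q : {poly C}) m : (size q <= m.+1)%N ->
  (size (\prod_(z <- s) (z^* *: 'X - 1) * q)%R <= (size s + m).+1)%N /\
  (\prod_(z <- s) (z^* *: 'X - 1) * q)`_(size s + m) = \prod_(z <- s) z^* * q`_m.
Proof.
move=> sq; elim: s => [|z s [IHs IHc]]; first by rewrite !big_nil !mul1r.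
rewrite !big_cons -!mulrA /= addSn; set p := _ * q in IHs IHc *.
rewrite (mulrBl p) -(scalerAl _ 'X p) mul1r; split.
  rewrite (leq_trans (size_polyD _ _)) // size_polyN geq_max (leq_trans IHs) // andbT.
  by rewrite (leq_trans (size_scale_leq _ _)) // (leq_trans (size_polyMleq _ _)) // size_polyX ltnS.
by rewrite coefB coefZ coefXM /= (nth_default _ IHs) subr0 IHc.
Qed.

(* Landau's inequality: trading X - z for z^* X - 1 does not change the 2-norm. *)
Lemma prod_norm_le_norm2 (s t : seq C) :
  \prod_(z <- s) `|z| ^+ 2 <=
  \sum_(i < (size (s ++ t)).+1) `|(\prod_(z <- s ++ t) ('X - z%:P))`_i| ^+ 2.
Proof.
rewrite big_cat norm2_prod_reflect size_cat ?size_prod_XsubC ?addnS //.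
set q := \prod_(_ <- t) _.
have [|_ hl] := @prod_reflect_top s q (size t); first by rewrite size_prod_XsubC.
have q1 : q`_(size t) = 1.
  by have := monicP (monic_prod_XsubC t xpredT id); rewrite lead_coefE size_prod_XsubC.
rewrite big_ord_recr /= hl q1 mulr1 normr_prod -prodrXl.
under [X in _ <= _ + X]eq_bigr do rewrite norm_conjC.
by rewrite lerDr sumr_ge0 // => i _; rewrite exprn_ge0.
Qed.

End Landau.

(** * Moduli as real numbers *)

Section ComplexModulus.

Variable R : realType.
Local Notation C := R[i].
Local Notation nc := (@Normc.normc R).

Lemma norm_nc (z : C) : `|z| = real_complex R (nc z).
Proof. by []. Qed.

Lemma nc_ge0 (z : C) : 0 <= nc z.
Proof. by rewrite -lecR -norm_nc normr_ge0. Qed.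

Lemma nc0 : nc (0 : C) = 0.
Proof. exact: Normc.normc0. Qed.

Lemma nc1 : nc (1 : C) = 1.
Proof. exact: Normc.normc1. Qed.

Lemma ncM (z w : C) : nc (z * w) = nc z * nc w.
Proof. exact: Normc.normcM. Qed.

Lemma ncD (z w : C) : nc (z + w) <= nc z + nc w.
Proof. exact: le_normcD. Qed.

Lemma ncN (z : C) : nc (- z) = nc z.
Proof. exact: normcN. Qed.

Lemma ncB (z w : C) : nc (z - w) <= nc z + nc w.
Proof. by rewrite -(ncN w) ncD. Qed.

Lemma ncX (z : C) n : nc (z ^+ n) = nc z ^+ n.
Proof.
elim: n => [|n IH]; first by rewrite !expr0; exact: nc1.
by rewrite !exprS ncM IH.
Qed.

Lemma nc_sum (I : Type) (s : seq I) (P : pred I) (F : I -> C) :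
  nc (\sum_(i <- s | P i) F i) <= \sum_(i <- s | P i) nc (F i).
Proof.
elim/big_rec2: _ => [|i y1 y2 _ IH]; first by rewrite nc0.
by rewrite (le_trans (ncD _ _)) // lerD2l.
Qed.

Lemma nc_real (x : R) : nc (real_complex R x) = `|x|.
Proof. by rewrite /Normc.normc /= expr0n /= addr0 sqrtr_sqr. Qed.

Lemma nc_int (m : int) : nc m%:~R = (absz m)%:R.
Proof.
have -> : m%:~R = real_complex R m%:~R by rewrite rmorph_int.
by rewrite nc_real -intr_norm -abszE.
Qed.

Lemma nc_eq0 (z : C) : (nc z == 0) = (z == 0).
Proof. by rewrite -(inj_eq (@complexI R)) -norm_nc rmorph0 normr_eq0. Qed.

Lemma nc_coef_intr (f : {poly int}) i :
  nc (map_poly (intr : int -> C) f)`_i = (absz f`_i)%:R.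
Proof. by rewrite coef_map nc_int. Qed.

Lemma map_ratr_intr (f : {poly int}) :
  map_poly (ratr : rat -> C) (map_poly (intr : int -> rat) f) = map_poly (intr : int -> C) f.
Proof. by rewrite -map_poly_comp; apply: eq_map_poly => x /=; rewrite ratr_int. Qed.

Lemma monic_prod_croots (p : {poly C}) :
  p \is monic -> p = \prod_(z <- croots p) ('X - z%:P).
Proof.
move=> mp; rewrite /croots; case: closed_field_poly_normal => s /= {1}->.
by rewrite (monicP mp) scale1r.
Qed.

(** [croots] is an unspecified list of roots; any complete factorisation is a permutation of it, so
    the count may be made on a convenient one. *)
Lemma nb_max_modulus_rootsP (p : {poly C}) (s : seq C) (r : R) :
  p = \prod_(z <- s) ('X - z%:P) -> (forall z, z \in s -> nc z <= r) ->
  has (fun z => nc z == r) s ->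
  nb_max_modulus_roots p = count (fun z => nc z == r) s.
Proof.
move=> ps sr /hasP[x xs /eqP xr].
have mp : p \is monic by rewrite ps monic_prod_XsubC.
have pc : perm_eq (croots p) s.
  by apply: prod_XsubC_eq; rewrite -ps -monic_prod_croots.
have -> : nb_max_modulus_roots p = count (fun z => nc z == max_modulus p) s.
  exact: (permP pc).
suff -> : max_modulus p = r by [].
rewrite /max_modulus; apply/eqP; rewrite eq_le; apply/andP; split.
  rewrite big_seq; elim/big_rec: _ => [|z a zc ar]; first by rewrite -xr nc_ge0.
  by rewrite ge_max ar andbT sr // -(perm_mem pc).
rewrite -xr; move: xs; rewrite -(perm_mem pc); elim: (croots p) => // y t IH.
rewrite inE big_cons le_max => /orP[/eqP->|/IH->]; by rewrite ?lexx ?orbT.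
Qed.

Lemma max_modulus_ge (p : {poly C}) z : z \in croots p -> nc z <= max_modulus p.
Proof.
rewrite /max_modulus; elim: (croots p) => // y t IH.
by rewrite inE big_cons le_max => /orP[/eqP->|/IH->]; rewrite ?lexx ?orbT.
Qed.

(** Up to sign the coefficient is an elementary symmetric function of the roots; the power of 2
    majorises the binomial coefficient. *)
Lemma prod_XsubC_coef_bound (s : seq C) (r : R) i :
  (forall z, z \in s -> nc z <= r) -> (i <= size s)%N ->
  nc (\prod_(z <- s) ('X - z%:P))`_i <= 2 ^+ size s * r ^+ (size s - i).
Proof.
elim: s i => [|z s IH] i sr.
  by rewrite leqn0 => /eqP->; rewrite big_nil coef1 expr0 mulr1 nc1.
move=> is1; have zr : nc z <= r by apply: sr; rewrite mem_head.
have r0 : 0 <= r by exact: le_trans (nc_ge0 z) zr.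
have {}sr w : w \in s -> nc w <= r by move=> ws; apply: sr; rewrite inE ws orbT.
rewrite big_cons mulrBl coefB coefXM coefCM (le_trans (ncB _ _)) //.
rewrite /= exprS -mulrA mulr_natl mulr2n; apply: lerD.
  case: i is1 => [|i] is1; first by rewrite eqxx nc0 mulr_ge0 ?exprn_ge0.
  by rewrite subSS /= IH.
rewrite ncM; move: is1; rewrite leq_eqVlt => /orP[/eqP->|is1].
  rewrite nth_default ?size_prod_XsubC // nc0 mulr0.
  by rewrite mulr_ge0 ?exprn_ge0.
rewrite subSn -1?ltnS // exprS mulrCA; apply: ler_pM; rewrite ?nc_ge0 //.
by apply: IH => //; rewrite -ltnS.
Qed.

Lemma max_modulus_pow_bound (s t : seq C) (r H : R) :
  0 <= r -> 0 <= H ->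
  (forall z, z \in s -> nc z = r) ->
  (forall i, nc (\prod_(z <- s ++ t) ('X - z%:P))`_i <= H) ->
  r ^+ size s <= (size (s ++ t)).+1%:R * H.
Proof.
move=> r0 H0 sr fH; have := prod_norm_le_norm2 s t.
set n := (size _).+1; set f := \prod_(z <- s ++ t) _ in fH *.
rewrite (eq_big_seq (fun=> real_complex R r ^+ 2)); last first.
  by move=> z zs; rewrite norm_nc sr.
rewrite big_const_seq count_predT iter_mulr_1 => /le_trans H1.
have {}H1 : (real_complex R r ^+ 2) ^+ size s <= \sum_(i < n) real_complex R H ^+ 2.
  apply: H1; apply: ler_sum => i _; rewrite ler_pXn2r ?nnegrE ?normr_ge0 ?ler0c //.
  by rewrite norm_nc lecR.
move: H1; rewrite sumr_const card_ord -!rmorphXn -rmorphMn lecR => H1.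
rewrite -(ler_pXn2r (n := 2)) ?nnegrE ?mulr_ge0 ?exprn_ge0 //.
rewrite exprAC (le_trans H1) // exprMn -mulr_natl ler_wpM2r ?exprn_ge0 //.
by rewrite -natrX ler_nat /n; nia.
Qed.

End ComplexModulus.

(** * Polynomials with a dominant subleading coefficient *)

Section Dominant.

Variable R : realType.
Local Notation C := R[i].
Local Notation nc := (@Normc.normc R).

(** With n = [size s] and a the subleading coefficient, f(z) = 0 makes z ^ (n - 1) (z + a) the
    opposite of the terms of degree below n - 1, which a geometric series bounds by H (|z| ^ (n - 1)
    - 1) / (|z| - 1). *)
Lemma large_root_near_coef (s : seq C) (H : R) (z : C) :
  let f := \prod_(z <- s) ('X - z%:P) in
  z \in s -> (forall i, (i < size s)%N -> nc f`_i <= H) -> 1 < nc z ->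
  (nc z - 1) * nc (z + f`_(size s).-1) <= H.
Proof.
move=> f zs fH z1.
have : f.[z] = 0 by apply/rootP; rewrite root_prod_XsubC.
rewrite (horner_coef_wide _ (n := (size s).+1)) ?size_prod_XsubC //.
case sm: (size s) fH => [|m] fH; first by move: zs; rewrite (size0nil sm).
rewrite !big_ord_recr /=.
have -> : f`_m.+1 = 1.
  have := monicP (monic_prod_XsubC s xpredT id).
  by rewrite lead_coefE size_prod_XsubC sm.
rewrite mul1r -addrA => /eqP; rewrite addrC addr_eq0 exprS -mulrDl addrC => /eqP E.
have zm0 : 0 < nc z ^+ m by rewrite exprn_gt0 // (lt_trans _ z1).
have H0 : 0 <= H by rewrite (le_trans _ (fH 0%N _)) ?nc_ge0.
rewrite -(ler_pM2r zm0) -mulrA -ncX -ncM E ncN.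
apply: (@le_trans _ _ ((nc z - 1) * \sum_(i < m) H * nc z ^+ i)).
  apply: ler_wpM2l; first by rewrite subr_ge0 ltW.
  apply: (le_trans (nc_sum _ _ _)).
  apply: ler_sum => i _; rewrite ncM ncX ler_wpM2r ?exprn_ge0 ?nc_ge0 //.
  by rewrite fH // (ltn_trans (ltn_ord i)).
rewrite -mulr_sumr mulrCA -subrX1 ncX ler_wpM2l // gerBl ler01 //.
Qed.

(* A root z either has modulus less than 1 + 2D or is within 4D of -a, where -a is
   the sum of the roots; comparing sizes, exactly one is of the second kind. *)
Lemma one_large_root (s : seq C) (H D : R) :
  let f := \prod_(z <- s) ('X - z%:P) in
  (0 < size s)%N -> (forall i, (i < size s)%N -> nc f`_i <= H) -> 1 <= D ->
  H <= D * nc f`_(size s).-1 -> 7 * (size s)%:R * D ^+ 2 < H ->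
  count (fun z => 1 + 2 * D <= nc z) s = 1%N.
Proof.
move=> f s0 fH D1 HD DH; set a := f`_(size s).-1 in HD.
have m1 : 1 <= (size s)%:R :> R by rewrite ler1n.
set m := (size s)%:R in DH m1.
have D0 : 0 < D by lra.
have DDm : D <= m * D ^+ 2 by nra.
(* Bootstrap: the crude bound |z + a| <= H / (2 D) yields H <= 2 D |z| <= 4 D (|z| - 1), and a
   second use of the same inequality gives 4 D. *)
have near z : z \in s -> 1 + 2 * D <= nc z -> nc (z + a) <= 4 * D.
  move=> zs z1; have E := large_root_near_coef zs fH (lt_le_trans _ z1).
  have {}E : (nc z - 1) * nc (z + a) <= H by apply: E; lra.
  have za0 := nc_ge0 (z + a).
  have E1 : 2 * D * nc (z + a) <= H by nra.
  have E2 : nc a <= nc z + nc (z + a).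
    have := ncB (z + a) z; have -> : z + a - z = a by rewrite addrC addKr.
    by rewrite addrC.
  have E3 : H <= 2 * D * nc z by nra.
  have E4 : H <= 4 * D * (nc z - 1) by nra.
  rewrite leNgt; apply/negP => E5.
  have : 4 * D * (nc z - 1) < (nc z - 1) * nc (z + a).
    by rewrite mulrC ltr_pM2l //; lra.
  by lra.
(* The left side adds a once per large root to the sum -a of all roots. Its terms are at most 4 D in
   modulus, so |t - 1| |a| <= 4 D m < |a| for the number t of large roots. *)
have sumE : \sum_(z <- s) (if 1 + 2 * D <= nc z then z + a else z) =
   ((count (fun z => 1 + 2 * D <= nc z) s)%:R - 1) * a.
  transitivity (\sum_(z <- s) z + \sum_(z <- s) (if 1 + 2 * D <= nc z then a else 0)).
    rewrite -big_split; apply: eq_bigr => z _ /=.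
    by case: ifP; rewrite ?addr0.
  have -> : \sum_(z <- s) z = - a.
    by rewrite /a /f coefPn_prod_XsubC ?opprK // -lt0n.
  rewrite -big_mkcond big_const_seq iter_addr_0 mulrBl mul1r.
  by rewrite [_%:R * a]mulr_natl addrC.
have : nc (((count (fun z => 1 + 2 * D <= nc z) s)%:R - 1) * a) <= 4 * D * m.
  rewrite -sumE (le_trans (nc_sum _ _ _)) //.
  have -> : 4 * D * m = \sum_(z <- s) 4 * D.
    by rewrite big_const_seq count_predT iter_addr_0 mulr_natr.
  rewrite big_seq [leRHS]big_seq; apply: ler_sum => z zs; case: ifP => [|/negbT].
    exact: near.
  by rewrite -ltNge; lra.
set t := count _ _.
have -> : (t%:R - 1 : C) = (t%:Z - 1)%:~R by rewrite intrB.
rewrite ncM nc_int => E.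
have a0 := nc_ge0 a.
suff : (absz (t%:Z - 1) < 1)%N by lia.
rewrite ltnNge; apply/negP => t1.
have {}t1 : 1 <= (absz (t%:Z - 1))%:R :> R by rewrite ler1n.
by nra.
Qed.

End Dominant.

(** * Counting polynomials in a box *)

Definition monic_of (n : nat) (c : nat -> int) : {poly int} :=
  'X^n + \poly_(i < n) c i.

Lemma coef_monic_of n c i :
  (monic_of n c)`_i = if (i < n)%N then c i else (i == n)%:R.
Proof.
rewrite coefD coefXn coef_poly; case: ltngtP => // _; rewrite ?add0r ?addr0 //.
Qed.

Lemma monic_of_monic n c : monic_of n c \is monic /\ size (monic_of n c) = n.+1.
Proof.
have lt : (size (\poly_(i < n) c i)%R < size ('X^n : {poly int})%R)%N.
  by rewrite size_polyXn ltnS size_poly.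
by rewrite monicE lead_coefDl // lead_coefXn size_polyDl // size_polyXn.
Qed.

Lemma monic_ofP n (f : {poly int}) :
  f \is monic -> size f = n.+1 -> f = monic_of n (fun i => f`_i).
Proof.
move=> mf sf; apply/polyP => i; rewrite coef_monic_of.
case: ltngtP => // [ni|->]; first by rewrite nth_default // sf.
by have := monicP mf; rewrite lead_coefE sf.
Qed.

Lemma height_leP (f : {poly int}) (H : nat) :
  reflect (forall i, (absz (f`_i)%R <= H)%N) (height f <= H)%N.
Proof.
apply: (iffP idP) => [hf i|fH]; last by apply/bigmax_leqP => i _; exact: fH.
have [si|si] := ltnP i (size f); last by rewrite nth_default.
exact: leq_trans (leq_bigmax (Ordinal si)) hf.
Qed.

Lemma card_fset_set_image (U : choiceType) (T : finType) (S : set U) (G : T -> U) :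
  finite_set S -> (forall f, S f -> exists t, f = G t) -> (#|` fset_set S| <= #|T|)%N.
Proof.
move=> finS SG; rewrite cardT -(size_map G).
apply: uniq_leq_size; first exact: fset_uniq.
move=> f; rewrite in_fset_set // inE => /SG[t ->].
by apply: map_f; rewrite mem_enum.
Qed.

Lemma card_fset_set_inj (U : choiceType) (T : finType) (S : set U) (A : {pred T}) (G : T -> U) :
  finite_set S -> (forall t, t \in A -> S (G t)) -> {in A &, injective G} ->
  (#|A| <= #|` fset_set S|)%N.
Proof.
move=> finS AG injG; rewrite cardE -(size_map G); apply: uniq_leq_size.
  by rewrite map_inj_in_uniq ?enum_uniq // => x y; rewrite !mem_enum; exact: injG.
move=> f /mapP[t]; rewrite mem_enum => tA ->.
by rewrite in_fset_set // inE; exact: AG.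
Qed.

(** [Phi] will be the identity for general k, and composition with X ^ k for odd k. *)
Lemma card_monic_box (S : set {poly int}) (Phi : {poly int} -> {poly int}) n (B : nat -> nat) :
  finite_set S ->
  (forall f, S f -> exists g, [/\ f = Phi g, g \is monic, size g = n.+1 &
     forall i, (i < n)%N -> (absz (g`_i)%R <= B i)%N]) ->
  (#|` fset_set S| <= \prod_(i < n) (B i + B i).+1)%N.
Proof.
move=> finS SB; pose T := {dffun forall i : 'I_n, 'I_(B i + B i).+1}.
pose c (t : T) (j : nat) : int :=
  if insub j is Some i then (t i : nat)%:Z - (B i)%:Z else 0.
have -> : (\prod_(i < n) (B i + B i).+1 = #|{: T}|)%N.
  by rewrite card_dep_ffun foldrE big_map big_enum /=; apply: eq_bigr => i _; rewrite card_ord.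
apply: (card_fset_set_image (G := fun t : T => Phi (monic_of n (c t)))) => // f.
move=> /SB[g [-> mg sg gB]].
exists [ffun i : 'I_n => inord (absz (g`_i + (B i)%:Z))]; congr (Phi _).
rewrite {1}(monic_ofP mg sg); apply/polyP => j; rewrite !coef_monic_of.
case: ltnP => // jn; rewrite /c; case: insubP => [i _ <-|]; last by rewrite jn.
by have gBi := gB _ (ltn_ord i); rewrite -[\val i]/(nat_of_ord i) ffunE inordK; lia.
Qed.

(** * Upper bound for arbitrary k *)

Section UpperBound.

Variable R : realType.
Local Notation nc := (@Normc.normc R).

Lemma powR_bigprod (x : R) n (e : nat -> R) : 0 < x ->
  \prod_(i < n) x `^ (e i) = x `^ (\sum_(i < n) e i).
Proof.
move=> x0; elim: n => [|n IH]; first by rewrite !big_ord0 powRr0.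
by rewrite !big_ord_recr /= IH powRD // (gt_eqF x0) implybT.
Qed.

Lemma sum_minn_exponents n k : (1 <= k <= n)%N ->
  \sum_(i < n) ((minn (n - i) k)%:R / k%:R) = n%:R - (k%:R - 1) / 2 :> R.
Proof.
move=> /andP[k1 kn]; have k0 : k%:R != 0 :> R by rewrite pnatr_eq0 -lt0n.
have small d : (d <= k)%N -> (2 * \sum_(i < d) minn i.+1 k = d * d.+1)%N.
  elim: d => [|d IH] dk; first by rewrite big_ord0.
  by rewrite big_ord_recr /= mulnDr IH ?(ltnW dk) //; lia.
have large d : (2 * \sum_(i < k + d) minn i.+1 k + k * k.-1 = 2 * (k + d) * k)%N.
  elim: d => [|d IH]; first by rewrite addn0 small //; nia.
  rewrite addnS big_ord_recr /= mulnDr addnAC IH; nia.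
rewrite -mulr_suml -natr_sum.
have -> : (\sum_(i < n) minn (n - i) k = \sum_(i < n) minn i.+1 k)%N.
  rewrite (reindex_inj rev_ord_inj); apply: eq_bigr => i _ /=.
  by rewrite subKn.
have := large (n - k)%N; rewrite subnKC //.
move/(congr1 (fun j => j%:R : R)); rewrite natrD !natrM => E.
have k1E : k.-1%:R = k%:R - 1 :> R by rewrite -subn1 natrB.
rewrite k1E in E; apply: (mulfI k0); rewrite mulrC divfK //; lra.
Qed.

Lemma max_modulus_poly_bounds (n k H : nat) (f : {poly int}) :
  max_modulus_polys R n k H f ->
  exists r : R, [/\ 0 <= r, r ^+ k <= n.+1%:R * H%:R &
    forall i, (i < n)%N -> (absz (f`_i)%R)%:R <= 2 ^+ n * r ^+ (n - i)].
Proof.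
move=> [mf sf /height_leP hf _]; set p := map_poly _ f => nbk.
have mp : p \is monic by exact: monic_map.
have pE := monic_prod_croots mp.
have sp : size p = n.+1 by rewrite size_map_inj_poly //; exact: intr_inj.
have sc : size (croots p) = n by move: sp; rewrite {1}pE size_prod_XsubC => -[].
set r := max_modulus p in nbk.
have r0 : 0 <= r.
  case E : (croots p) sc => [|z t] sc; first by rewrite /r /max_modulus E big_nil.
  by rewrite (le_trans (nc_ge0 z)) // max_modulus_ge // E mem_head.
exists r; split=> //; last first.
  move=> i ilt; rewrite -nc_coef_intr -/p pE -sc.
  apply: prod_XsubC_coef_bound; last by rewrite sc ltnW.
  exact: max_modulus_ge.
pose a z := nc z == r.
have pst : perm_eq ([seq z <- croots p | a z] ++ [seq z <- croots p | predC a z]) (croots p).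
  exact/permPl/perm_filterC.
have sst : size ([seq z <- croots p | a z] ++ [seq z <- croots p | predC a z]) = n.
  by rewrite (perm_size pst).
rewrite -[k in r ^+ k]nbk /nb_max_modulus_roots -size_filter -/a -sst.
apply: max_modulus_pow_bound => // [z|i]; first by rewrite mem_filter => /andP[/eqP].
by rewrite (perm_big _ pst) /= -pE nc_coef_intr ler_nat.
Qed.

(* Since r ^ k = O(H), the coefficient of X ^ (n - j) is O(H ^ (min (j, k) / k)). *)
Lemma nb_max_modulus_polys_upper (n k : nat) : (1 <= k <= n)%N ->
  exists2 c : R, 0 < c & forall H : nat, (1 <= H)%N ->
    (nb_max_modulus_polys R n k H)%:R <= c * H%:R `^ (n%:R - (k%:R - 1) / 2).
Proof.
(* 2 ^ n comes from the bound on coefficients by roots, [n.+1] from Landau's inequality, and 3 from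
   2 b + 1 <= 3 b for b >= 1. *)
move=> /andP[k1 kn]; pose c0 : R := 3 * 2 ^+ n * n.+1%:R.
have c00 : 0 < c0 by rewrite !mulr_gt0 // exprn_gt0.
exists (c0 ^+ n); first by rewrite exprn_gt0.
move=> H H1; have k0 : 0 < k%:R :> R by rewrite ltr0n.
have hR : 1 <= H%:R :> R by rewrite ler1n.
pose rho : R := (n.+1%:R * H%:R) `^ (k%:R^-1).
have n1 : 1 <= n.+1%:R :> R by rewrite ler1n.
have X1 : 1 <= n.+1%:R * H%:R :> R by nra.
have rho1 : 1 <= rho.
  have E1 : (1 : R) `^ (k%:R^-1) = 1 by rewrite powR1.
  by rewrite -[leLHS]E1 ge0_ler_powR ?invr_ge0 ?nnegrE //; lra.
pose B i : nat := if (n - i <= k)%N then Num.truncn (2 ^+ n * rho ^+ (n - i)) else H.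
have rpow i : 0 <= 2 ^+ n * rho ^+ (n - i) by rewrite mulr_ge0 ?exprn_ge0 //; lra.
have cardB : (nb_max_modulus_polys R n k H <= \prod_(i < n) (B i + B i).+1)%N.
  apply: (card_monic_box (Phi := id)); first exact: finite_max_modulus_polys.
  move=> f fS; exists f; have [mf sf /height_leP hf _ _] := fS; split=> // i ilt.
  rewrite /B; case: ifP => // _; have [r [r0 rk fr]] := max_modulus_poly_bounds fS.
  rewrite truncn_ge_nat // (le_trans (fr _ ilt)) //.
  rewrite ler_wpM2l ?exprn_ge0 // lerXn2r ?nnegrE //; first by lra.
  have -> : r = (r ^+ k) `^ (k%:R^-1).
    by rewrite -powR_mulrn // -powRrM divff ?gt_eqF // powRr1.
  by rewrite ge0_ler_powR ?invr_ge0 ?nnegrE ?exprn_ge0 //; lra.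
apply: (@le_trans _ _ (\prod_(i < n) (c0 * H%:R `^ ((minn (n - i) k)%:R / k%:R)))); last first.
  rewrite big_split /= prodr_const card_ord (powR_bigprod n (fun i => (minn (n - i) k)%:R / k%:R)); last by lra.
  by rewrite sum_minn_exponents // k1.
apply: (@le_trans _ _ (\prod_(i < n) (B i + B i).+1%:R)).
  by rewrite -natr_prod ler_nat.
apply: ler_prod => i _; rewrite ler0n /=.
have p2 : 1 <= 2 ^+ n :> R by rewrite exprn_ege1 // ler1n.
rewrite /B; case: (leqP (n - i) k) => nik; last first.
  rewrite divff ?gt_eqF // powRr1 ?ler0n //.
  rewrite -addn1 !natrD; rewrite /c0; nra.
have E : rho ^+ (n - i) <= n.+1%:R * H%:R `^ ((n - i)%:R / k%:R).
  have r0 : 0 <= rho by lra.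
  rewrite -powR_mulrn // /rho -powRrM [k%:R^-1 * _]mulrC powRM ?ler0n //.
  rewrite ler_wpM2r ?powR_ge0 // -[leRHS]powRr1 ?ler0n // ler_powR //.
  by rewrite ler_pdivrMr // mul1r ler_nat.
have rr : 1 <= rho ^+ (n - i) by rewrite exprn_ege1.
have := truncn_le (2 ^+ n * rho ^+ (n - i)); rewrite rpow => T.
rewrite -addn1 !natrD; rewrite /c0.
have : 2 ^+ n * rho ^+ (n - i) <= 2 ^+ n * (n.+1%:R * H%:R `^ ((n - i)%:R / k%:R)).
  by rewrite ler_wpM2l //; lra.
nra.
Qed.

End UpperBound.

(** * Asymptotics for odd k *)

Section OddCount.

Variable R : realType.
Local Notation C := R[i].
Local Notation nc := (@Normc.normc R).

Lemma odd_max_modulus_polys_comp (n k H : nat) (f : {poly int}) :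
  (2 <= n)%N -> odd k -> max_modulus_polys R n k H f ->
  exists g : {poly int}, [/\ f = g \Po 'X^k, g \is monic, ((size g).-1 * k = n)%N &
    forall i, (absz (g`_i)%R <= H)%N].
Proof.
move=> n2 oddk [mf sf /height_leP hf irrf]; set p := map_poly _ f => nbk.
have mp : p \is monic by exact: monic_map.
have k0 : (0 < k)%N by case: (k) oddk.
have pE := monic_prod_croots mp.
have sp : size p = n.+1 by rewrite size_map_inj_poly //; exact: intr_inj.
have sc : size (croots p) = n by move: sp; rewrite {1}pE size_prod_XsubC => -[].
have fE : map_poly (ratr : rat -> C) (pZtoQ f) = \prod_(z <- croots p) ('X - z%:P).
  by rewrite map_ratr_intr -pE.
have mfq : pZtoQ f \is monic by exact: monic_map.
pose r := max_modulus p.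
(* The roots are distinct and there are at least two of them, so they cannot all be 0. *)
have r0 : 0 < real_complex R r.
  have := irr_rat_roots_uniq irrf fE.
  rewrite ltcR; case E : (croots p) sc => [|z [|w t]] sc; try by move: n2; rewrite -sc.
  rewrite /= inE negb_or => /andP[/andP[zw _] _].
  have := @max_modulus_ge R p z; have := @max_modulus_ge R p w; rewrite E !inE !eqxx orbT.
  move=> /(_ isT) wr /(_ isT) zr; rewrite ltNge; apply/negP => r0.
  move: zw; have /eqP : nc z = 0 by apply/eqP; rewrite eq_le nc_ge0 (le_trans zr).
  have /eqP : nc w = 0 by apply/eqP; rewrite eq_le nc_ge0 (le_trans wr).
  by rewrite !nc_eq0 => /eqP-> /eqP->; rewrite eqxx.
have sr z : z \in croots p -> `|z| <= real_complex R r.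
  by move=> zp; rewrite norm_nc lecR; exact: max_modulus_ge.
have sS : size [seq z <- croots p | `|z| == real_complex R r] = k.
  rewrite size_filter -nbk; apply: eq_count => z.
  by rewrite norm_nc (inj_eq (@complexI R)).
have [|h mh fh] := odd_max_roots_comp mfq irrf fE r0 sr; first by rewrite sS.
rewrite sS in fh.
have hE i : h`_i = (f`_(i * k))%:~R.
  have := congr1 (fun q : {poly rat} => q`_(i * k)) fh.
  by rewrite coef_comp_poly_Xn // dvdn_mull // mulnK // coef_map /= => ->.
pose g : {poly int} := \poly_(i < size h) f`_(i * k).
have gh : pZtoQ g = h.
  apply/polyP => i; rewrite coef_map coef_poly /= hE; case: ltnP => // sh.
  by rewrite -hE nth_default.
have injZ : injective pZtoQ by apply: map_inj_poly => //; exact: intr_inj.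
have fg : f = g \Po 'X^k.
  by apply: injZ; rewrite map_comp_poly /= map_polyXn gh.
exists g; split=> //.
- move: mh; rewrite -gh !monicE lead_coef_map_inj //; last exact: intr_inj.
  by rewrite -[1]/(1%:~R) eqr_int.
- have := congr1 (fun q : {poly int} => (size q).-1) fg.
  by rewrite sf /= size_comp_poly size_polyXn /= => ->.
- by move=> i; rewrite coef_poly; case: ifP.
Qed.

Lemma odd_not_dvd_count0 (n k H : nat) : (2 <= n)%N -> odd k -> ~~ (k %| n)%N ->
  nb_max_modulus_polys R n k H = 0%N.
Proof.
move=> n2 oddk kn; suff E : max_modulus_polys R n k H = set0.
  by rewrite /nb_max_modulus_polys E fset_set0 cardfs0.
apply/seteqP; split=> // f /odd_max_modulus_polys_comp[] // g [_ _ E _].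
by move: kn; rewrite -E dvdn_mull.
Qed.

Lemma odd_dvd_count_upper (n k H : nat) : (2 <= n)%N -> odd k -> (k %| n)%N ->
  (nb_max_modulus_polys R n k H <= (H + H).+1 ^ (n %/ k))%N.
Proof.
move=> n2 oddk /dvdnP[m nE]; have k0 : (0 < k)%N by case: (k) oddk.
rewrite nE mulnK // -[X in (_ ^ X)%N](card_ord m) -prod_nat_const.
apply: (card_monic_box (Phi := fun g => g \Po 'X^k) (B := fun=> H)).
  exact: finite_max_modulus_polys.
rewrite -nE => f /odd_max_modulus_polys_comp[] // g [fg mg sg gH].
exists g; split=> //; move/eqP: sg; rewrite nE eqn_pmul2r // => /eqP <-.
by rewrite prednK // size_poly_gt0 monic_neq0.
Qed.

End OddCount.

(** * Polynomials with a single large root *)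

Section DominantCount.

Variable R : realType.
Local Notation C := R[i].
Local Notation nc := (@Normc.normc R).
Local Notation pZtoC := (map_poly (intr : int -> C)).

Lemma monic_croots_intr (f : {poly int}) : f \is monic ->
  pZtoC f = \prod_(z <- croots (pZtoC f)) ('X - z%:P) /\
  size f = (size (croots (pZtoC f))).+1.
Proof.
move=> mf; have E : pZtoC f = \prod_(z <- croots (pZtoC f)) ('X - z%:P).
  by apply: monic_prod_croots; exact: monic_map.
split=> //; have <- : size (pZtoC f) = size f by rewrite size_map_inj_poly //; exact: intr_inj.
by rewrite {1}E size_prod_XsubC.
Qed.

(* In a factorisation, the factor without the large root has bounded coefficients. *)
Lemma one_large_root_irreducible (g : {poly int}) (B : R) (M : nat) :
  g \is monic -> (1 < size g)%N -> 1 <= B ->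
  count (fun z => B <= nc z) (croots (pZtoC g)) = 1%N ->
  2 ^+ (size g).-1 * B ^+ (size g).-1 <= M%:R ->
  (forall v w : {poly int}, g = v * w -> v \is monic -> (1 < size v)%N ->
     ~ forall i, (absz (v`_i)%R <= M)%N) ->
  irreducible_poly (pZtoQ g).
Proof.
move=> mg sg B1 large1 BM nodiv; set big := fun z => B <= nc z in large1.
have gN0 : pZtoQ g != 0 by exact: monic_neq0 (monic_map _ mg).
split; first by rewrite size_map_inj_poly //; exact: intr_inj.
move=> q sq qg; have q0 : q != 0 by apply: contraTneq qg => ->; rewrite dvd0p.
pose u := (lead_coef q)^-1 *: q.
have lq0 : lead_coef q != 0 by rewrite lead_coef_eq0.
have uq : u %= q by rewrite eqp_scale // invr_eq0.
have mu : u \is monic by rewrite monicE lead_coefZ mulVf.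
have ug : u %| pZtoQ g by rewrite (eqp_dvdl _ uq).
have su : size u = size q by rewrite size_scale // invr_eq0.
have [v [w [mv uv gvw]]] := monic_rat_dvd_int mu mg ug.
have sv : size v = size q by rewrite -su uv size_map_inj_poly //; exact: intr_inj.
have mw : w \is monic by move: mg; rewrite gvw monicMl.
have [vE svE] := monic_croots_intr mv; have [wE swE] := monic_croots_intr mw.
have [gE sgE] := monic_croots_intr mg.
have pg : perm_eq (croots (pZtoC g)) (croots (pZtoC v) ++ croots (pZtoC w)).
  by apply: prod_XsubC_eq; rewrite big_cat /= -gE -vE -wE gvw rmorphM.
have small (x y : {poly int}) : g = x * y -> x \is monic -> (1 < size x)%N ->
    (size x <= size g)%N -> ~~ has big (croots (pZtoC x)) -> False.
  move=> gxy mx sx sxg /hasPn nb; apply: (nodiv x y) => // i.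
  have [xE sxE] := monic_croots_intr mx.
  have [six|six] := ltnP i (size x); last by rewrite nth_default.
  rewrite -(ler_nat R) -nc_coef_intr xE (le_trans _ BM) //.
  apply: le_trans (prod_XsubC_coef_bound (r := B) _ _) _.
  - by move=> z /nb; rewrite /big -ltNge => /ltW.
  - by move: six; rewrite {1}sxE ltnS.
  apply: ler_pM; rewrite ?exprn_ge0 //; first lra.
    by rewrite ler_weXn2l ?ler1n // -ltnS -sxE prednK // ltnW.
  rewrite ler_weXn2l // (leq_trans (leq_subr _ _)) //.
  by rewrite -ltnS -sxE prednK // ltnW.
have v0 := monic_neq0 mv; have w0 := monic_neq0 mw.
have sgvw : size g = (size v + size w).-1 by rewrite gvw size_mul.
have sv1 : (1 < size v)%N.
  by rewrite sv ltn_neqAle eq_sym sq size_poly_gt0.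
have sw0 : (0 < size w)%N by rewrite size_poly_gt0.
have svg : (size v <= size g)%N.
  by rewrite sgvw; case: (size w) sw0 => // j _; rewrite addnS leq_addr.
have swg : (size w <= size g)%N.
  by rewrite sgvw; case: (size v) (ltnW sv1) => // j _; rewrite addSn leq_addl.
move: large1; rewrite (permP pg) count_cat => large1.
have [nv|vbig] := posnP (count big (croots (pZtoC v))).
  by case: (small v w gvw mv sv1 svg); rewrite has_count nv.
have nw : count big (croots (pZtoC w)) = 0%N.
  by case: (count big _) vbig large1 => // j _; rewrite addSn => -[] /eqP; rewrite addn_eq0 => /andP[_ /eqP].
have [sw1|sw1] := leqP (size w) 1; last first.
  by case: (small w v _ mw sw1 swg); rewrite ?has_count ?nw // mulrC.
have w1 : w = 1.
  have := monicP mw; rewrite (size1_polyC sw1) lead_coefC => ->.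
  by rewrite polyC1.
by rewrite -(eqp_ltrans uq) uv gvw w1 mulr1 eqpxx.
Qed.

(** The k-th roots of the large root share one modulus, and those of the other roots are strictly
    smaller. *)
Lemma one_large_root_comp_nb (g : {poly int}) (k : nat) (B : R) :
  g \is monic -> (0 < k)%N -> 0 < B ->
  count (fun z => B <= nc z) (croots (pZtoC g)) = 1%N ->
  nb_max_modulus_roots (pZtoC (g \Po 'X^k)) = k.
Proof.
move=> mg k0 B0; have [gE _] := monic_croots_intr mg.
set s := croots _ in gE *; set big := fun z => B <= nc z => large1.
have /hasP[b bs bb] : has big s by rewrite has_count large1.
have bE z : z \in s -> big z -> z = b.
  move=> zs zb; have /permP pr := perm_to_rem bs.
  move: large1; rewrite pr /= bb => -[] cr; apply/eqP; rewrite -[_ == _]negbK; apply/negP => zNb.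
  have : z \in rem b s.
    have := perm_mem (perm_to_rem bs) z; rewrite zs inE (negbTE zNb) /= => <- //.
  by move=> zr; move: cr; apply/eqP; rewrite -lt0n -has_count; apply/hasP; exists z.
pose rt w := croots ('X^k - w%:P : {poly C}).
have rtE w : 'X^k - w%:P = \prod_(z <- rt w) ('X - z%:P).
  by apply: monic_prod_croots; exact: monicXnsubC.
have rtk w z : z \in rt w -> nc z ^+ k = nc w.
  rewrite -ncX => zw; congr nc; apply/eqP.
  have : root ('X^k - w%:P) z by rewrite rtE root_prod_XsubC.
  by rewrite /root !hornerE subr_eq0.
have srt w : size (rt w) = k.
  by have := congr1 (fun q : {poly C} => size q) (rtE w); rewrite /= size_prod_XsubC size_XnsubC // => -[].
have pE : pZtoC (g \Po 'X^k) = \prod_(z <- flatten [seq rt w | w <- s]) ('X - z%:P).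
  rewrite map_comp_poly /= map_polyXn gE rmorph_prod big_flatten big_map.
  by apply: eq_bigr => w _; rewrite -rtE /= comp_polyB comp_polyX comp_polyC.
case Erb : (rt b) (srt b) => [|y t] sb; first by rewrite -sb in k0.
have yb : y \in rt b by rewrite Erb mem_head.
have nb_lt w : w \in s -> ~~ big w -> nc w < nc b.
  by move=> _; rewrite /big -ltNge => wB; exact: lt_le_trans bb.
rewrite (nb_max_modulus_rootsP (r := nc y) pE).
- rewrite count_flatten -map_comp sumnE big_map big_seq.
  transitivity (\sum_(w <- s | w \in s) (if big w then k else 0))%N.
    apply: eq_bigr => w ws /=; case: ifP => [wb|/negbT wb].
      rewrite -(srt w); apply/eqP; rewrite -all_count; apply/allP => z zw /=.
      rewrite -(eqrXn2 k0 (nc_ge0 z) (nc_ge0 y)) (rtk _ _ zw) (rtk _ _ yb).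
      by rewrite (bE _ ws wb).
    apply/eqP; rewrite -leqn0 leqNgt -has_count; apply/hasP => -[z zw /= /eqP zy].
    have := nb_lt w ws wb; rewrite -(rtk _ _ zw) -(rtk _ _ yb) zy ltxx //.
  by rewrite -big_seq -big_mkcond big_const_seq iter_addn_0 large1 muln1.
- move=> z /flattenP[_ /mapP[w ws ->] zw].
  rewrite -(ler_pXn2r k0) ?nnegrE ?nc_ge0 // (rtk _ _ zw) (rtk _ _ yb).
  by case: (boolP (big w)) => [/(bE _ ws)->//|/(nb_lt _ ws)/ltW].
- apply/hasP; exists y => //; apply/flattenP; exists (rt b) => //.
  by apply/mapP; exists b.
Qed.

End DominantCount.

(** * Exceptional polynomials in a box *)

Section Slices.

Variables (m H : nat).
Local Notation T := {ffun 'I_m.+1 -> 'I_(H + H).+1}.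

(** Forgetting the coordinate [i0] is injective on [A]. *)
Lemma card_slice (A : {pred T}) (i0 : 'I_m.+1) :
  (forall t t', t \in A -> t' \in A -> (forall i, i != i0 -> t i = t' i) -> t = t') ->
  (#|A| <= (H + H).+1 ^ m)%N.
Proof.
move=> Aeq; pose G (t : T) : {ffun 'I_m -> 'I_(H + H).+1} := [ffun j => t (lift i0 j)].
have -> : ((H + H).+1 ^ m = #|{: {ffun 'I_m -> 'I_(H + H).+1}}|)%N.
  by rewrite card_ffun !card_ord.
apply: (@leq_card_in _ _ G) => t t' tA t'A /ffunP tt'; apply: Aeq => // i.
by case: (unliftP i0 i) => [j ->|->]; [have := tt' j; rewrite !ffunE|rewrite eqxx].
Qed.

Lemma card_union_slices (J : finType) (A : J -> {pred T}) (i0 : J -> 'I_m.+1) (Bad : {pred T}) :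
  (forall j t t', t \in A j -> t' \in A j -> (forall i, i != i0 j -> t i = t' i) -> t = t') ->
  (forall t, t \in Bad -> exists j, t \in A j) ->
  (#|Bad| <= #|J| * (H + H).+1 ^ m)%N.
Proof.
move=> Aeq BA; apply: (@leq_trans (\sum_j #|A j|)); last first.
  by rewrite -sum_nat_const; apply: leq_sum => j _; exact: card_slice (Aeq j).
rewrite -sum1_card; under [leqRHS]eq_bigr do rewrite -sum1_card.
rewrite (exchange_big_dep xpredT) //= [leqLHS]big_mkcond; apply: leq_sum => t _.
case: ifP => // /BA[j tj]; rewrite (bigD1 j) //=.
Qed.

Definition box_coef (t : T) (j : nat) : int :=
  if insub j is Some i then (t i : nat)%:Z - H%:Z else 0.

Lemma box_coef_ord (t : T) (i : 'I_m.+1) : box_coef t i = (t i : nat)%:Z - H%:Z.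
Proof. by rewrite /box_coef valK. Qed.

Lemma box_coef_le (t : T) j : (absz (box_coef t j) <= H)%N.
Proof.
by rewrite /box_coef; case: insubP => [i _ _|_] //; have := ltn_ord (t i); lia.
Qed.

Lemma box_coef_inj (t t' : T) (i : 'I_m.+1) :
  box_coef t i = box_coef t' i -> t i = t' i.
Proof. by rewrite !box_coef_ord => E; apply: val_inj => /=; lia. Qed.

Lemma box_coef_surj (c : nat -> int) :
  (forall i, (i < m.+1)%N -> (absz (c i) <= H)%N) ->
  exists t : T, forall i, (i < m.+1)%N -> box_coef t i = c i.
Proof.
move=> cH; exists [ffun i : 'I_m.+1 => inord (absz (c i + H%:Z))] => i im.
rewrite (_ : i = nat_of_ord (Ordinal im)) // box_coef_ord ffunE.
by have ciH := cH _ im; rewrite inordK /=; lia.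
Qed.

End Slices.

(* The polynomials to which both irreducibility criteria apply; M bounds the
   coefficients of a divisor without the large root. *)
Definition good_poly (m H k D M : nat) (g : {poly int}) : Prop :=
  [/\ (H <= D * absz (g`_m)%R)%N,
      (forall v w : {poly int}, g = v * w -> v \is monic -> (1 < size v)%N ->
         ~ forall i, (absz (v`_i)%R <= M)%N) &
      (forall y d : nat, (1 < d <= k)%N -> absz g`_0 <> (y ^ d)%N)].

Lemma absz_sign (x : int) : exists b : bool, x = (-1) ^+ b * (absz x)%:Z.
Proof. by exists (x < 0); rewrite -intEsign. Qed.

(** The parenthesised factor counts slices: small values of the subleading coefficient, up to sign;
    possible divisors with coefficients at most M; and values of g(0) of the form y ^ d up to sign,
    where d >= 2 and |g(0)| <= H force y <= Y. Each slice determines one coefficient from the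
    others. *)
Lemma card_good_poly (m H k D M Y : nat) : (0 < D)%N -> (H < Y.+1 ^ 2)%N ->
  ((H + H).+1 ^ m.+1 <=
   #|[pred t : {ffun 'I_m.+1 -> 'I_(H + H).+1} |
        `[< good_poly m H k D M (monic_of m.+1 (box_coef t)) >]]| +
   ((H %/ D).+1 * 2 + m.+1 * (M + M).+1 ^ m.+1 + Y.+1 * k.+1 * 2) * (H + H).+1 ^ m)%N.
Proof.
move=> D0 HY; pose T := ({ffun 'I_m.+1 -> 'I_(H + H).+1} : finType); set good := [pred t | _].
have -> : ((H + H).+1 ^ m.+1 = #|{: T}|)%N by rewrite card_ffun !card_ord.
rewrite -(cardC good) leq_add2l.
pose J := (('I_(H %/ D).+1 * bool) + ('I_m.+1 * {ffun 'I_m.+1 -> 'I_(M + M).+1})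
   + ('I_Y.+1 * 'I_k.+1 * bool))%type.
pose P (t : T) := monic_of m.+1 (box_coef t).
have P0 t : (P t)`_0 = box_coef t 0 by rewrite coef_monic_of.
have Pm t : (P t)`_m = box_coef t m by rewrite coef_monic_of ltnSn.
pose A (j : J) : {pred T} := match j with
  | inl (inl (x, b)) => [pred t | box_coef t m == (-1) ^+ (b : bool) * (x : nat)%:Z]
  | inl (inr (d, u)) => [pred t | `[< exists w, P t = monic_of d.+1 (box_coef u) * w >]]
  | inr (y, d, b) => [pred t | box_coef t 0 == (-1) ^+ (b : bool) * ((y : nat) ^ d)%N%:Z]
  end.
pose i0 (j : J) : 'I_m.+1 := match j with inl (inl _) => ord_max | _ => ord0 end.
have -> : ((H %/ D).+1 * 2 + m.+1 * (M + M).+1 ^ m.+1 + Y.+1 * k.+1 * 2 = #|{: J}|)%N.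
  by rewrite !card_sum !card_prod card_ffun !card_ord card_bool.
apply: (@card_union_slices _ _ J A i0).
  move=> [[[x b]|[d u]]|[[y d] b]] t t' /= tA t'A tt'; apply/ffunP => i.
  - have [->|] := eqVneq i ord_max; last exact: tt'.
    by apply: box_coef_inj; move: tA t'A; rewrite !inE => /eqP-> /eqP->.
  - have [->|] := eqVneq i ord0; last exact: tt'.
    apply: box_coef_inj; rewrite -!P0.
    move: tA t'A => /asboolP[w Pw] /asboolP[w' Pw'].
    have [ww'|ww'] := eqVneq w w'; first by have -> : P t = P t' by rewrite [LHS]Pw [RHS]Pw' ww'.
    have [mv sv] := monic_of_monic d.+1 (box_coef u).
    (* Two multiples of the same monic nonconstant v that differ by a constant are equal, since v
       divides that constant. *)
    have : P t - P t' = ((P t)`_0 - (P t')`_0)%:P.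
      apply/polyP => j; rewrite coefB coefC; case: eqP => [->//|/eqP j0].
      rewrite !coef_monic_of; case: ltnP => jm; last by rewrite subrr.
      rewrite (_ : j = nat_of_ord (Ordinal jm)) // !box_coef_ord tt' ?subrr //.
    rewrite {1}Pw {1}Pw' -mulrBr => /(congr1 (fun q : {poly int} => size q)).
    rewrite size_monicM ?subr_eq0 // sv size_polyC.
    have : (0 < size (w - w')%R)%N by rewrite size_poly_gt0 subr_eq0.
    by case: (size (w - w')%R) => // j _ /eqP; rewrite addnS 2!addSn; case: (_ != 0).
  - have [->|] := eqVneq i ord0; last exact: tt'.
    by apply: box_coef_inj; move: tA t'A; rewrite !inE => /eqP-> /eqP->.
move=> t; rewrite inE /good inE => /asboolP ngood.
have [mP sP] := monic_of_monic m.+1 (box_coef t); rewrite -/(P t) in mP sP ngood.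
apply: contrapT => noA; apply: ngood; split.
- rewrite Pm leqNgt; apply/negP => small; apply: noA.
  have [b tb] := absz_sign (box_coef t m).
  have lx : (absz (box_coef t m) < (H %/ D).+1)%N.
    by rewrite ltnS leq_divRL // mulnC ltnW.
  by exists (inl (inl (Ordinal lx, b))); rewrite inE /= {1}tb.
- move=> v w Pvw mv sv vM; apply: noA.
  have w0 : w != 0 by apply: contraTneq mP => w0; rewrite Pvw w0 mulr0 monicE lead_coef0.
  have svm : (size v <= m.+2)%N.
    rewrite -sP Pvw size_monicM //; move: w0; rewrite -size_poly_gt0.
    by case: (size w) => // j _; rewrite addnS leq_addr.
  have [u uE] := @box_coef_surj m M (fun i => v`_i) (fun i _ => vM i).
  have dlt : ((size v).-2 < m.+1)%N by case: (size v) sv svm => [|[|j]].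
  exists (inl (inr (Ordinal dlt, u))); apply/asboolP; exists w => /=.
  rewrite Pvw; congr (_ * _); have sv2 : size v = (size v).-2.+2 by case: (size v) sv => [|[|j]].
  rewrite {1}(monic_ofP mv sv2); apply/polyP => i; rewrite !coef_monic_of.
  case: ltnP => // iv; rewrite uE //; exact: leq_trans iv dlt.
- move=> y d /andP[d1 dk] yd; apply: noA.
  have [b tb] := absz_sign (box_coef t 0).
  have ly : (y < Y.+1)%N.
    rewrite ltnNge; apply/negP => Yy; have : (y ^ d <= H)%N by rewrite -yd P0 box_coef_le.
    rewrite leqNgt (leq_trans HY) //; apply: (@leq_trans (y ^ 2)); first by rewrite leq_exp2r.
    by rewrite leq_pexp2l // (leq_trans _ Yy).
  exists (inr (Ordinal ly, Ordinal (dk : (d < k.+1)%N), b)); rewrite inE /= {1}tb.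
  by rewrite -P0 yd.
Qed.

(** * The limit for odd k dividing n *)

Section DividingCount.

Variable R : realType.
Local Notation C := R[i].
Local Notation nc := (@Normc.normc R).

Lemma good_poly_max_modulus (m k H D M : nat) (g : {poly int}) :
  (0 < k)%N -> (0 < D)%N -> (2 ^ m.+1 * (1 + 2 * D) ^ m.+1 <= M)%N ->
  (7 * m.+1 * D ^ 2 < H)%N ->
  g \is monic -> size g = m.+2 -> (forall i, (absz (g`_i)%R <= H)%N) ->
  good_poly m H k D M g ->
  max_modulus_polys R (m.+1 * k) k H (g \Po 'X^k).
Proof.
move=> k0 D0 DM DH mg sg gH [g1 g2 g3].
have [gE sgE] := monic_croots_intr R mg; set s := croots _ in gE sgE.
have ss : size s = m.+1 by move: sgE; rewrite sg => -[].
have large1 : count (fun z => 1 + 2 * D%:R <= nc z) s = 1%N.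
  apply: (@one_large_root _ s H%:R D%:R); rewrite ?ss -?gE //.
  - by move=> i _; rewrite nc_coef_intr ler_nat.
  - by rewrite ler1n.
  - by rewrite nc_coef_intr -natrM ler_nat.
  - by rewrite -natrX -!natrM ltr_nat.
have irrg : irreducible_poly (map_poly (intr : int -> rat) g).
  apply: (@one_large_root_irreducible R g (1 + 2 * D%:R) M) => //.
  - by rewrite sg.
  - by rewrite lerDl mulr_ge0.
  - by rewrite sg /= -natrM -[1 + _]/(1%:R + _) -natrD -!natrX -natrM ler_nat.
split.
- exact: monic_comp_polyXn.
- have := size_comp_poly g 'X^k; rewrite sg size_polyXn /= => <-.
  by rewrite prednK // size_poly_gt0 monic_neq0 // monic_comp_polyXn.
- by apply/height_leP => i; rewrite coef_comp_poly_Xn //; case: ifP.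
- exact: irr_comp_polyXn.
- by apply: (one_large_root_comp_nb (B := 1 + 2 * D%:R)) => //; rewrite addr_gt0 // mulr_gt0 ?ltr0n.
Qed.

Lemma dvd_count_lower (m k D : nat) : (0 < k)%N -> (0 < D)%N ->
  exists K : nat, forall H : nat, (K <= H)%N ->
   ((H + H).+1 ^ m.+1 <= nb_max_modulus_polys R (m.+1 * k) k H +
      (4 * (H %/ D) + K) * (H + H).+1 ^ m)%N.
Proof.
move=> k0 D0; pose M := (2 ^ m.+1 * (1 + 2 * D) ^ m.+1)%N.
(* With Y = H / E, the slices of perfect powers cost 2 (H / D) up to a constant, as do those of the
   subleading coefficient, hence the factor 4. The condition E ^ 2 <= H ensures H < (Y + 1) ^ 2. *)
pose E := (D * k.+1)%N; pose c := (m.+1 * (M + M).+1 ^ m.+1)%N.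
exists (2 + c + k.+1 * 2 + E * E + (7 * m.+1 * D ^ 2).+1)%N => H KH.
pose Y := (H %/ E)%N.
have EH : (E * E <= H)%N by apply: leq_trans KH; lia.
have cH : (7 * m.+1 * D ^ 2 < H)%N by apply: leq_trans KH; lia.
have HY : (H < Y.+1 ^ 2)%N.
  have E0 : (0 < E)%N by rewrite muln_gt0 D0.
  have YE := ltn_ceil H E0; rewrite -/Y in YE.
  have EY : (E < Y.+1)%N by rewrite -(ltn_pmul2r E0) (leq_ltn_trans EH).
  by rewrite (leq_trans YE) // -mulnn leq_mul2l ltnW.
have := card_good_poly m k M D0 HY => /leq_trans; apply.
apply: leq_add.
  apply: (@card_fset_set_inj _ _ _ _ (fun t => monic_of m.+1 (box_coef t) \Po 'X^k)).
  - exact: finite_max_modulus_polys.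
  - move=> t /asboolP good; have [mg sg] := monic_of_monic m.+1 (box_coef t).
    apply: (good_poly_max_modulus (D := D) (M := M)) => // i.
    rewrite coef_monic_of; case: ifP => _; first exact: box_coef_le.
    by case: eqP => // _; rewrite absz1 (leq_ltn_trans _ cH).
  - move=> t t' _ _ tt'; apply/ffunP => i; apply: box_coef_inj.
    have := congr1 (fun q : {poly int} => q`_(i * k)) tt'.
    by rewrite !coef_comp_poly_Xn // dvdn_mull // mulnK // !coef_monic_of ltn_ord.
rewrite leq_mul2r; apply/orP; right.
have YD : (Y * k.+1 <= H %/ D)%N by rewrite /Y /E divnMA leq_trunc_div.
rewrite -/c; lia.
Qed.

Lemma expr1D_le (t : R) m : 0 <= t <= 1 -> (1 + t) ^+ m <= 1 + 3 ^+ m * t.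
Proof.
move=> /andP[t0 t1]; elim: m => [|m IH]; first by rewrite !expr0; lra.
have m1 : 1 <= 3 ^+ m :> R by rewrite exprn_ege1 // ler1n.
rewrite !exprS; apply: le_trans (ler_wpM2l _ IH) _; first by lra.
have pt : t <= 3 ^+ m * t by rewrite ler_peMl.
have ptt : 3 ^+ m * t * t <= 3 ^+ m * t by rewrite ler_piMr // mulr_ge0 //; lra.
lra.
Qed.

Lemma odd_dvd_count_cvg (n k : nat) : (2 <= n)%N -> odd k -> (k %| n)%N ->
  (fun H : nat => (nb_max_modulus_polys R n k H)%:R / (2 * H%:R) `^ (n%:R / k%:R) : R)
    @ \oo --> (1 : R).
Proof.
move=> n2 oddk kn; have k0 : (0 < k)%N by case: (k) oddk.
have upper H := odd_dvd_count_upper R H n2 oddk kn.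
move: kn n2 upper => /dvdnP[[|m] nE] n2; first by rewrite nE in n2.
rewrite nE mulnK // => upper.
have -> : (m.+1 * k)%:R / k%:R = m.+1%:R :> R by rewrite natrM mulfK // pnatr_eq0 -lt0n.
apply/cvgrPdist_le => e e0.
(* [D] makes 4 H / D at most e H, and [N] below makes K at most e H; together the loss is e x with x
   = 2 H. *)
pose D := (Num.truncn (4 / e)).+1.
have De : 4 <= e * D%:R.
  rewrite mulrC -ler_pdivrMr // ltW //.
  by have /andP[] := truncn_itv (ltW (divr_gt0 (ltr0n R 4) e0)).
have [K lower] := dvd_count_lower m k0 (ltn0Sn _ : (0 < D)%N).
pose N := ((Num.truncn ((3 ^+ m.+1 + K%:R) / e)).+1 + K)%N.
have p3 : 0 <= 3 ^+ m.+1 :> R by rewrite exprn_ge0.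
have Ne (H : nat) : (N <= H)%N -> 3 ^+ m.+1 + K%:R <= e * H%:R.
  move=> NH; rewrite mulrC -ler_pdivrMr // ltW //.
  have /andP[_] := truncn_itv (divr_ge0 (addr_ge0 p3 (ler0n R K)) (ltW e0)).
  by move=> /lt_le_trans; apply; rewrite ler_nat (leq_trans _ NH) // leq_addr.
exists N => // H /= NH; have {Ne} := Ne _ NH => Ne.
have KH : (K <= H)%N by rewrite (leq_trans _ NH) // leq_addl.
have H0 : (0 < H)%N by rewrite (leq_trans _ NH) // /N addSn.
have {lower} := lower _ KH; have {upper} := upper H.
set nb := nb_max_modulus_polys _ _ _ _.
rewrite -!(ler_nat R) !(natrD, natrM, natrX) -(natr1 (H + H)) natrD.
have hR : 1 <= H%:R :> R by rewrite ler1n.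
rewrite powR_mulrn; last by lra.
set x : R := 2 * H%:R; have -> : H%:R + H%:R = x by rewrite /x; ring.
have x0 : 0 < x by rewrite /x; lra.
have x1 : 2 <= x by rewrite /x; lra.
have nb0 : 0 <= nb%:R :> R by rewrite ler0n.
move=> upper lower; rewrite -lerBlDr in lower.
have xm0 : 0 < x ^+ m.+1 by rewrite exprn_gt0.
have K0 : 0 <= K%:R :> R by rewrite ler0n.
have quo : (H %/ D)%:R * D%:R <= H%:R :> R by rewrite -natrM ler_nat leq_trunc_div.
have D1 : 1 <= D%:R :> R by rewrite ler1n.
have quo' : 4 * (H %/ D)%:R <= e * H%:R.
  have q0 : 0 <= (H %/ D)%:R :> R by rewrite ler0n.
  by nra.
rewrite ler_norml; apply/andP; split.
  have : nb%:R / x ^+ m.+1 <= 1 + e.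
    rewrite ler_pdivrMr // (le_trans upper) //.
    have -> : x + 1 = x * (1 + x^-1) by rewrite mulrDr mulr1 divff ?gt_eqF.
    rewrite exprMn mulrC ler_pM2r // (le_trans (expr1D_le _ _)) //.
      by rewrite invr_ge0 ltW //= invf_le1 //; lra.
    rewrite lerD2l ler_pdivrMr // /x; nra.
  by lra.
have : 1 - e <= nb%:R / x ^+ m.+1; last by lra.
have [e1|e1] := leP e 1; last first.
  by apply: (@le_trans _ _ 0); [lra|rewrite divr_ge0 // ltW].
rewrite ler_pdivlMr // (le_trans _ lower) //.
rewrite !exprS -mulrBl mulrA.
set b := 4 * _ + _; have bx : b <= e * x by rewrite /b /x; nra.
have x10 : 0 <= x + 1 by lra.
have xm : x ^+ m <= (x + 1) ^+ m by rewrite lerXn2r ?nnegrE ?lerDl ?ler01 // ltW.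
have xm1 : 0 < x ^+ m by rewrite exprn_gt0.
have lx : (1 - e) * x <= x + 1 - b by lra.
have ex0 : 0 <= (1 - e) * x by rewrite mulr_ge0 ?subr_ge0 // ltW.
apply: ler_pM ex0 (ltW xm1) lx xm.
Qed.

End DividingCount.

(** * Polynomials with all roots on a circle *)

Section RealRoots.

Variable R : realType.

(* The roots (l + 1/2) / m of center_poly separate the nodes i / m, so that every
   polynomial close to it changes sign between consecutive nodes. *)
Definition node (m i : nat) : R := i%:R / m%:R.

Definition center_poly (m : nat) : {poly R} :=
  \prod_(l < m) ('X - ((l%:R + 1 / 2) / m%:R)%:P).

Lemma center_poly_monic m : center_poly m \is monic /\ size (center_poly m) = m.+1.
Proof.
rewrite /center_poly; split; first exact: monic_prod_XsubC.
by rewrite -big_enum size_prod_XsubC size_enum_ord.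
Qed.

(** Every root is at distance at least 1 / (2 m) from every node. *)
Lemma center_poly_node_ge m i : (0 < m)%N -> (i <= m)%N ->
  (2 * m%:R) ^- m <= `|(center_poly m).[node m i]|.
Proof.
move=> m0 im; have mR : 0 < m%:R :> R by rewrite ltr0n.
rewrite /center_poly horner_prod normr_prod -exprVn -[X in _ ^+ X]card_ord -prodr_const.
apply: ler_prod => l _; rewrite hornerXsubC /node invr_ge0 mulr_ge0 //= -mulrBl normrM.
rewrite invfM (ger0_norm (x := m%:R^-1)) ?invr_ge0 // ler_wpM2r ?invr_ge0 //.
have [li|il] := leqP i l.
  have : i%:R <= l%:R :> R by rewrite ler_nat.
  by move=> ?; rewrite ler0_norm; lra.
have : l%:R + 1 <= i%:R :> R by rewrite natr1 ler_nat.
by move=> ?; rewrite ger0_norm; lra.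
Qed.

(** Only the factor with l = i changes sign between the two nodes. *)
Lemma center_poly_node_lt0 m i : (i < m)%N ->
  (center_poly m).[node m i] * (center_poly m).[node m i.+1] < 0.
Proof.
move=> im; have mR : 0 < m%:R :> R by rewrite ltr0n (leq_ltn_trans _ im).
rewrite /center_poly !horner_prod -big_split (bigD1 (Ordinal im)) //=.
have E (l : nat) : ('X - ((l%:R + 1 / 2) / m%:R)%:P).[node m i] *
   ('X - ((l%:R + 1 / 2) / m%:R)%:P).[node m i.+1] =
   ((i%:R - l%:R - 1 / 2) * (i%:R - l%:R + 1 / 2)) / m%:R ^+ 2.
  by rewrite !hornerXsubC /node -natr1; field; rewrite gt_eqF.
rewrite nmulr_rlt0; last by rewrite E subrr pmulr_llt0 ?invr_gt0 ?exprn_gt0 //; lra.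
apply: prodr_gt0 => l li; rewrite E divr_gt0 ?exprn_gt0 //.
have : l != i :> nat by [].
rewrite neq_ltn => /orP[] lt.
  have : l%:R + 1 <= i%:R :> R by rewrite natr1 ler_nat.
  by nra.
have : i%:R + 1 <= l%:R :> R by rewrite natr1 ler_nat.
by nra.
Qed.

Lemma mul_lt0_perturb (a b a' b' h : R) :
  a * b < 0 -> h <= `|a| -> h <= `|b| -> `|a' - a| < h -> `|b' - b| < h -> a' * b' < 0.
Proof.
move=> ab ha hb; rewrite !ltr_norml => /andP[a1 a2] /andP[b1 b2].
have [a0|a0] := lerP 0 a; [rewrite ger0_norm // in ha|rewrite ltr0_norm // in ha].
  have b0 : b < 0 by rewrite ltNge; apply/negP => b0; nra.
  by rewrite ltr0_norm // in hb; rewrite pmulr_rlt0; lra.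
have b0 : 0 < b by rewrite ltNge; apply/negP => b0; nra.
by rewrite gtr0_norm // in hb; rewrite nmulr_rlt0; lra.
Qed.

(** On [0, 1], g(w x) and w ^ m G(x) differ by at most w ^ m m e, the tolerances being weighted so
    that all powers of w combine to w ^ m. This is less than the least possible value of |w ^ m G|
    at a node, so the m sign changes persist and each yields a root. *)
Lemma real_roots_near_center (m : nat) (g : {poly R}) (w e : R) :
  (0 < m)%N -> 0 < w -> 0 <= e -> m%:R * e < (2 * m%:R) ^- m ->
  g \is monic -> size g = m.+1 ->
  (forall i, (i < m)%N ->
     `|g`_i - (center_poly m)`_i * w ^+ (m - i)| <= e * w ^+ (m - i)) ->
  exists t : seq R, g = \prod_(c <- t) ('X - c%:P) /\ forall c, c \in t -> 0 < c < w.
Proof.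
move=> m0 w0 e0 me mg sg gnear; have mR : 0 < m%:R :> R by rewrite ltr0n.
have [mG sG] := center_poly_monic m; set G := center_poly m in mG sG gnear.
have near i : (i <= m)%N -> `|g.[w * node m i] - w ^+ m * G.[node m i]| < w ^+ m * (2 * m%:R) ^- m.
  move=> im; apply: (@le_lt_trans _ _ (w ^+ m * (m%:R * e))); last first.
    by rewrite ltr_pM2l // exprn_gt0.
  rewrite !(horner_coef_wide _ (n := m.+1)) ?sg ?sG // mulr_sumr -sumrB big_ord_recr /=.
  have gm : g`_m = 1 by have := monicP mg; rewrite lead_coefE sg.
  have Gm : G`_m = 1 by have := monicP mG; rewrite lead_coefE sG.
  rewrite gm Gm !mul1r exprMn subrr addr0.
  rewrite (le_trans (ler_norm_sum _ _ _)) //.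
  have -> : w ^+ m * (m%:R * e) = \sum_(j < m) w ^+ m * e.
    by rewrite sumr_const card_ord mulrCA mulr_natl.
  apply: ler_sum => j _; have wm : w ^+ m = w ^+ (m - j) * w ^+ j.
    by rewrite -exprD subnK // ltnW.
  have n01 : 0 <= node m i ^+ j <= 1.
    rewrite exprn_ge0 ?exprn_ile1 // /node ?divr_ge0 //.
    by rewrite ler_pdivrMr // mul1r ler_nat.
  have -> : g`_j * (w * node m i) ^+ j - w ^+ m * (G`_j * node m i ^+ j) =
     (g`_j - G`_j * w ^+ (m - j)) * w ^+ j * node m i ^+ j.
    by rewrite wm exprMn; ring.
  case/andP: n01 => n0 n1.
  have wj : 0 <= w ^+ j by rewrite exprn_ge0 // ltW.
  rewrite !normrM (ger0_norm n0) (ger0_norm wj).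
  apply: (@le_trans _ _ (e * w ^+ (m - j) * w ^+ j * 1)); last by rewrite wm; lra.
  by rewrite ler_pM ?mulr_ge0 // ler_wpM2r // gnear.
have ex (i : 'I_m) : exists x, root g x /\ w * node m i < x < w * node m i.+1.
  have lt : w * node m i <= w * node m i.+1.
    by rewrite ler_pM2l // ler_pM2r ?invr_gt0 // ler_nat.
  have sgn : g.[w * node m i] * g.[w * node m i.+1] < 0.
    have wm : 0 < w ^+ m by rewrite exprn_gt0.
    apply: (mul_lt0_perturb (a := w ^+ m * G.[node m i]) (b := w ^+ m * G.[node m i.+1]) _ _ _
       (near i _) (near i.+1 _)) => //; last exact: ltnW.
    - rewrite mulrACA pmulr_rlt0 ?mulr_gt0 //; exact: center_poly_node_lt0.
    - by rewrite normrM gtr0_norm // ler_pM2l // center_poly_node_ge // ltnW.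
    - by rewrite normrM gtr0_norm // ler_pM2l // center_poly_node_ge.
  have [x xin rx] := polyrcf.poly_ivtoo lt sgn; by exists x.
pose x i := xget 0 [set x | root g x /\ w * node m i < x < w * node m i.+1].
have xP (i : 'I_m) : root g (x i) /\ w * node m i < x i < w * node m i.+1.
  exact: (xgetPex 0 (ex i)).
have mono (i j : 'I_m) : (i < j)%N -> x i < x j.
  move=> ij; have [_ /andP[_ xi]] := xP i; have [_ /andP[xj _]] := xP j.
  apply: lt_trans xi _; apply: le_lt_trans xj.
  by rewrite ler_pM2l // ler_pM2r ?invr_gt0 // ler_nat.
pose t := [seq x (nat_of_ord i) | i <- enum 'I_m].
have ut : uniq t.
  rewrite map_inj_uniq ?enum_uniq // => i j xij; apply: val_inj => /=; apply/eqP.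
  by case: ltngtP => // /mono; rewrite xij ltxx.
exists t; split.
  rewrite [LHS](@all_roots_prod_XsubC _ g t) ?(monicP mg) ?scale1r //.
  - by rewrite sg size_map size_enum_ord.
  - by apply/allP => _ /mapP[i _ ->]; have [] := xP i.
  - by rewrite uniq_rootsE.
move=> _ /mapP[i _ ->]; have [_ /andP[x1 x2]] := xP i; apply/andP; split.
  by apply: le_lt_trans x1; rewrite mulr_ge0 ?divr_ge0 // ltW.
apply: lt_le_trans x2 _; apply: (ler_piMr (ltW w0)).
by rewrite /node ler_pdivrMr // mul1r ler_nat.
Qed.

End RealRoots.

(** As a has degree 2, a ^ i X ^ (m - i) has degree m + i; these degrees are distinct, so the
    leading term of a nonzero p - q would survive. *)
Lemma homog_X_inj (A : idomainType) (m : nat) (p q a : {poly A}) :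
  a \is monic -> size a = 3%N -> (size p <= m.+1)%N -> (size q <= m.+1)%N ->
  homog m p a 'X = homog m q a 'X -> p = q.
Proof.
move=> ma sa sp sq pq; apply/eqP; rewrite -subr_eq0; apply/negPn/negP => d0.
set d := p - q in d0; pose e := (size d).-1.
have sd : size d = e.+1 by rewrite prednK // size_poly_gt0.
have em : (e <= m)%N.
  by rewrite -ltnS -sd (leq_trans (size_polyD _ _)) // size_polyN geq_max sp.
have hd : homog m d a 'X = 0.
  apply/eqP; rewrite -(subrr (homog m p a 'X)) {2}pq /homog -sumrB; apply/eqP.
  by apply: eq_bigr => i _; rewrite coefB scalerBl.
have sz i : (i <= m)%N -> size (a ^+ i * 'X^(m - i)) = (m + i).+1.
  move=> im; have mai := monic_exp i ma.
  rewrite size_monicM ?monicXn ?monic_neq0 // ?monicXn // size_polyXn addnS /=.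
  have := size_exp a i; rewrite sa /= => E.
  rewrite -(prednK (n := size (a ^+ i))) ?size_poly_gt0 ?monic_neq0 // E; lia.
have := congr1 (fun r : {poly A} => r`_(m + e)) hd.
rewrite /homog coef_sum coef0 (bigD1 (inord e)) //= inordK // big1; last first.
  move=> i ie; rewrite coefZ; have [ei|ie'] := ltnP e i.
    have -> : d`_i = 0 by rewrite nth_default // sd.
    by rewrite mul0r.
  have lt : (i < e)%N.
    rewrite ltn_neqAle ie' andbT; apply: contra_neq ie => ie; apply: val_inj.
    by rewrite /= inordK // -ie.
  have im : (i <= m)%N by rewrite -ltnS.
  have -> : (a ^+ i * 'X^(m - i))`_(m + e) = 0 by rewrite nth_default // sz // ltn_add2l.
  by rewrite mulr0.
rewrite addr0 coefZ => /eqP; rewrite mulf_eq0.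
have -> : d`_e = lead_coef d by [].
rewrite lead_coef_eq0 (negbTE d0) /=.
have mm : a ^+ e * 'X^(m - e) \is monic by rewrite monicMl ?monicXn // monic_exp.
have := monicP mm; rewrite lead_coefE sz //= => ->.
by rewrite oner_eq0.
Qed.

Lemma eisenstein_two (m : nat) (g : {poly int}) : (0 < m)%N ->
  g \is monic -> size g = m.+1 -> (exists x, g`_0 = 4 * x + 2) ->
  (forall i, (0 < i < m)%N -> exists x, g`_i = 4 * x) ->
  irreducible_poly (pZtoQ g).
Proof.
move=> m0 mg sg [x g0] gi; apply/irreducible_rat_int; apply: (@eisenstein_crit 2) => //.
- by rewrite sg; case: (m) m0.
- by rewrite (monicP mg).
- by apply/negP => /dvdzP[y]; rewrite g0 expr2; lia.
- rewrite sg /= => -[|i] im; first by rewrite g0; apply/dvdzP; exists (2 * x + 1); lia.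
  by have [|y ->] := gi i.+1; rewrite ?im //; apply/dvdzP; exists (2 * y); lia.
Qed.

Section SelfInversiveCount.

Variable R : realType.
Local Notation C := R[i].
Local Notation nc := (@Normc.normc R).
Local Notation pZtoC := (map_poly (intr : int -> C)).

(** All 2 m roots have modulus w, so the coefficients are at most 2 ^ (2 m) w ^ (2 m): this is the
    origin of the condition on H. *)
Lemma self_inversive_max_modulus (m H rho : nat) (w : R) (g : {poly int}) (t : seq R) :
  (0 < m)%N -> 1 <= w -> w ^+ 2 = rho%:R -> (2 ^ m.*2 * rho ^ m <= H)%N ->
  g \is monic -> size g = m.+1 -> irreducible_poly (pZtoQ g) ->
  map_poly (intr : int -> R) g = \prod_(c <- t) ('X - c%:P) ->
  (forall c, c \in t -> 0 < c < w) ->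
  max_modulus_polys R m.*2 m.*2 H (homog m g ('X^2 + rho%:R%:P) 'X).
Proof.
move=> m0 w1 w2 rH mg sg irrg gt tw; set f := homog _ _ _ _.
pose tC : seq C := map (real_complex R) t.
have gC : pZtoC g = \prod_(c <- tC) ('X - c%:P).
  have -> : pZtoC g = map_poly (real_complex R) (map_poly (intr : int -> R) g).
    by rewrite -map_poly_comp; apply: eq_map_poly => x /=; rewrite rmorph_int.
  rewrite gt rmorph_prod big_map; apply: eq_bigr => c _.
  by rewrite /= map_polyXsubC.
have stC : size tC = m.
  have := congr1 (fun q : {poly C} => size q) gC.
  by rewrite size_prod_XsubC size_map_inj_poly ?sg //; [move=> -[]|exact: intr_inj].
have fC : pZtoC f = \prod_(c <- tC) ('X^2 + rho%:R%:P - c *: 'X).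
  rewrite map_homog /= gC -[X in homog X]stC homog_prod.
  by rewrite rmorphD /= map_polyXn map_polyC map_polyX /= rmorph_nat.
have [mfC sfC] := prod_quadratic tC (rho%:R : C); rewrite -fC stC in mfC sfC.
have mf : f \is monic.
  move: mfC; rewrite !monicE lead_coef_map_inj //; last exact: intr_inj.
  by rewrite -[1]/(1%:~R) eqr_int.
have sf : size f = m.*2.+1 by rewrite -sfC size_map_inj_poly //; exact: intr_inj.
have rhoR : (rho%:R : C) = real_complex R (w ^+ 2) by rewrite w2 rmorph_nat.
have tCP c : c \in tC -> c \is Num.real /\ c ^+ 2 < 4 * rho%:R.
  case/mapP => b bt ->; have /andP[b0 bw] := tw _ bt.
  split; first by apply/complex_realP; exists b.
  rewrite rhoR -(rmorph_nat (real_complex R) 4) -rmorphXn -rmorphM ltcR; nra.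
have [fE sfE] := monic_croots_intr R mf; rewrite sf in sfE; case: sfE => sfE.
have rootw z : z \in croots (pZtoC f) -> nc z = w.
  rewrite -root_prod_XsubC -fE fC /root horner_prod prodf_seq_eq0 => /hasP[c ct /=].
  rewrite !hornerE subr_eq0 => /eqP E; have [cr c2] := tCP _ ct.
  have := quadratic_root_norm cr c2 (realn _ _) E.
  rewrite norm_nc rhoR -rmorphXn => /complexI E2.
  apply/eqP; rewrite -(eqrXn2 (n := 2)) ?nc_ge0 ?E2 //; lra.
split=> //.
- apply/height_leP => i; have [ilt|ige] := ltnP i (size f); last first.
    by rewrite nth_default.
  rewrite sf ltnS sfE in ilt.
  rewrite -(ler_nat R) -nc_coef_intr fE.
  apply: le_trans (prod_XsubC_coef_bound (r := w) _ ilt) _; first by move=> z /rootw->.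
  apply: (@le_trans _ _ (2 ^+ m.*2 * w ^+ m.*2)).
    by rewrite -sfE ler_wpM2l ?exprn_ge0 // ler_weXn2l // leq_subr.
  by rewrite -mul2n [w ^+ _]exprM w2 mul2n -!natrX -natrM ler_nat.
- have -> : pZtoQ f = homog m (pZtoQ g) ('X^2 + (rho%:R)%:P) 'X.
    by rewrite map_homog /= rmorphD /= map_polyXn map_polyC map_polyX /= rmorph_nat.
  apply: (irr_self_inversive (t := tC)) => //.
  + exact: monic_map.
  + by rewrite size_map_inj_poly //; exact: intr_inj.
  + by rewrite map_ratr_intr.
  + by move=> c /tCP; rewrite ratr_nat.
- rewrite (nb_max_modulus_rootsP fE (r := w)).
  + rewrite [RHS]sfE; apply/eqP; rewrite -all_count; apply/allP => z zs /=.
    by rewrite rootw.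
  + by move=> z /rootw->.
  + case E : (croots _) sfE => [|z s] sE; first by move: sE m0; rewrite /= => /eqP; rewrite double_eq0 => /eqP->.
    by apply/hasP; exists z; rewrite ?mem_head //= rootw // E mem_head.
Qed.

End SelfInversiveCount.

(** * A large family for even n *)

Section EvenCount.

Variable R : realType.

Section Family.

Variables (m Y D : nat).
Hypotheses (m0 : (0 < m)%N) (DY : (D <= Y)%N) (D0 : (8 * m * (2 * m) ^ m < D)%N).

(** The first component selects rho between Y ^ 2 and 2 Y ^ 2, the second displaces the coefficients
    of g, that of X ^ j by a small fraction of Y ^ (m - j). The resulting tolerance is 8 / D, and
    [D0] says that m (8 / D) < (2 m) ^- m, as the persistence of the real roots requires. *)
Local Notation index := ('I_(Y * Y) * {dffun forall j : 'I_m, 'I_(Y ^ (m - j) %/ D)})%type.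

Definition fam_rho (x : index) : nat := (Y * Y + x.1)%N.

Definition fam_w (x : index) : R := Num.sqrt (fam_rho x)%:R.

Definition fam_base (x : index) (j : nat) : int :=
  Num.floor ((center_poly R m)`_j * fam_w x ^+ (m - j) / 4).

Definition fam_digit (x : index) (j : nat) : nat :=
  if insub j is Some i then x.2 i else 0%N.

(* Shifting by multiples of 4, and by 2 for the constant coefficient, makes
   fam_poly Eisenstein at 2. *)
Definition fam_coef (x : index) (j : nat) : int :=
  4 * (fam_base x j + (fam_digit x j)%:Z) + (if j == 0%N then 2 else 0).

Definition fam_poly (x : index) : {poly int} := monic_of m (fam_coef x).

Lemma fam_w_sqr (x : index) : fam_w x ^+ 2 = (fam_rho x)%:R.
Proof. by rewrite sqr_sqrtr. Qed.

Lemma fam_w_ge (x : index) : Y%:R <= fam_w x.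
Proof.
rewrite -(ler_pXn2r (n := 2)) ?nnegrE ?sqrtr_ge0 //.
by rewrite fam_w_sqr -natrX ler_nat -mulnn leq_addr.
Qed.

Lemma fam_digit_ord (x : index) (i : 'I_m) : fam_digit x i = x.2 i.
Proof. by rewrite /fam_digit valK. Qed.

(** With W the power of [fam_w x], rounding costs at most 4, the digit at most 4 W / D - 4 and the
    Eisenstein shift 2; since D <= W, all this fits into 8 W / D. *)
Lemma fam_coef_near (x : index) (i : nat) : (i < m)%N ->
  `|(fam_coef x i)%:~R - (center_poly R m)`_i * fam_w x ^+ (m - i)|
    <= 8 / D%:R * fam_w x ^+ (m - i).
Proof.
move=> im; set W := fam_w x ^+ (m - i); set G := _`_i.
have DR : 0 < D%:R :> R by rewrite ltr0n (leq_ltn_trans _ D0).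
have Y0 : (0 < Y)%N by apply: leq_trans DY; apply: leq_ltn_trans D0.
have YW : (Y ^ (m - i))%:R <= W.
  by rewrite natrX lerXn2r ?nnegrE ?sqrtr_ge0 // fam_w_ge.
have DW : D%:R <= W.
  apply: le_trans YW; rewrite ler_nat (leq_trans DY) // -{1}(expn1 Y).
  by rewrite leq_pexp2l // subn_gt0.
have : (fam_digit x i < Y ^ (m - i) %/ D)%N by rewrite (fam_digit_ord x (Ordinal im)).
set c := fam_digit x i; set q := (_ %/ D)%N => cq.
have {}cq : c%:R + 1 <= q%:R :> R by rewrite natr1 ler_nat.
have qY : q%:R * D%:R <= W by rewrite (le_trans _ YW) // -natrM ler_nat leq_trunc_div.
have /andP[f1 f2] := Num.Theory.floor_itv (G * W / 4); rewrite intrD in f2.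
set b := (Num.floor _)%:~R in f1 f2.
have -> : (fam_coef x i)%:~R = 4 * (b + c%:R) + (if i == 0%N then 2 else 0) :> R.
  by rewrite /fam_coef intrD intrM intrD; case: ifP.
have c0 : 0 <= c%:R :> R by rewrite ler0n.
have Wq : q%:R <= W / D%:R by rewrite ler_pdivlMr.
have W1 : 1 <= W / D%:R by rewrite ler_pdivlMr // mul1r.
have -> : 8 / D%:R * W = 8 * (W / D%:R) by rewrite mulrAC mulrA.
set V := W / D%:R in Wq W1 *.
by rewrite ler_norml; case: ifP => _; lra.
Qed.

Lemma fam_max_modulus (x : index) (H : nat) : (2 ^ m.*2 * (2 * (Y * Y)) ^ m <= H)%N ->
  max_modulus_polys R m.*2 m.*2 H (homog m (fam_poly x) ('X^2 + (fam_rho x)%:R%:P) 'X).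
Proof.
move=> YH; have Y0 : (0 < Y)%N by apply: leq_trans DY; apply: leq_ltn_trans D0.
have [mg sg] := monic_of_monic m (fam_coef x); rewrite -/(fam_poly x) in mg sg.
have DR : 0 < D%:R :> R by rewrite ltr0n (leq_ltn_trans _ D0).
have w1 : 1 <= fam_w x by apply: le_trans (fam_w_ge x); rewrite ler1n.
have [||||||t [gt tw]] := @real_roots_near_center R m (map_poly (intr : int -> R) (fam_poly x))
    (fam_w x) (8 / D%:R) m0.
- by lra.
- by rewrite divr_ge0.
- have m2 : 0 < (2 * m%:R) ^+ m :> R by rewrite exprn_gt0 // mulr_gt0 // ltr0n.
  rewrite -[ltRHS]mul1r ltr_pdivlMr // mulrA mulrAC ltr_pdivrMr // mul1r.
  by rewrite [m%:R * 8]mulrC -!natrM -natrX -natrM ltr_nat.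
- exact: monic_map.
- by rewrite size_map_inj_poly //; exact: intr_inj.
- move=> i im; rewrite coef_map coef_monic_of im; exact: fam_coef_near.
apply: (self_inversive_max_modulus (w := fam_w x) (t := t)) => //.
- exact: fam_w_sqr.
- apply: leq_trans YH; rewrite leq_mul2l; apply/orP; right.
  by rewrite leq_exp2r // mul2n -addnn leq_add2l ltnW.
- apply: (eisenstein_two m0 mg sg).
    by exists (fam_base x 0 + (fam_digit x 0)%:Z); rewrite coef_monic_of m0.
  move=> i /andP[i0 im]; exists (fam_base x i + (fam_digit x i)%:Z).
  by rewrite coef_monic_of im /fam_coef gtn_eqF // addr0.
Qed.

(** The value at 0 is rho ^ m and reveals rho; then g can be recovered, and rho also fixes the base
    from which the digits are read off. *)
Lemma fam_inj (x y : index) :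
  homog m (fam_poly x) ('X^2 + (fam_rho x)%:R%:P) 'X =
  homog m (fam_poly y) ('X^2 + (fam_rho y)%:R%:P) 'X -> x = y.
Proof.
have coef0 z : (homog m (fam_poly z) ('X^2 + (fam_rho z)%:R%:P) 'X).[0] = (fam_rho z)%:R ^+ m.
  rewrite /homog horner_sum big_ord_recr /= big1 => [|i _].
    rewrite add0r subnn expr0 mulr1 coef_monic_of ltnn eqxx scale1r.
    by rewrite horner_exp !hornerE ?expr0n ?mul0r ?add0r.
  by rewrite hornerZ hornerM hornerXn expr0n subn_eq0 leqNgt ltn_ord !mulr0.
move=> xy; have := congr1 (fun q : {poly int} => q.[0]) xy.
rewrite !coef0 -!natrX => /eqP; rewrite eqr_nat eqn_exp2r // eqn_add2l => /eqP x1.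
have rE : fam_rho x = fam_rho y by rewrite /fam_rho x1.
have [mx sx] := monic_of_monic m (fam_coef x); have [my sy] := monic_of_monic m (fam_coef y).
have gxy : fam_poly x = fam_poly y.
  have sr : (size ((fam_rho x)%:R%:P : {poly int}) < size ('X^2 : {poly int}))%N.
    by rewrite size_polyXn ltnS (leq_trans (size_polyC_leq1 _)).
  apply: (@homog_X_inj _ m _ _ ('X^2 + (fam_rho x)%:R%:P)).
  - by rewrite monicE lead_coefDl // lead_coefXn.
  - by rewrite size_polyDl // size_polyXn.
  - by rewrite sx.
  - by rewrite sy.
  - by rewrite xy rE.
case: x y x1 rE gxy {xy mx sx my sy} => [a c] [b d] /= /val_inj ab rE gxy.
rewrite -{}ab in rE gxy *; congr (_, _); apply/ffunP => j; apply: val_inj => /=.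
have := congr1 (fun q : {poly int} => q`_j) gxy.
rewrite !coef_monic_of ltn_ord /fam_coef /fam_base /fam_w rE !fam_digit_ord /=.
by move/addIr/(mulfI (isT : 4 != 0 :> int))/addrI => -[].
Qed.

Lemma fam_count (H : nat) : (2 ^ m.*2 * (2 * (Y * Y)) ^ m <= H)%N ->
  (Y * Y * \prod_(j < m) (Y ^ (m - j) %/ D) <= nb_max_modulus_polys R m.*2 m.*2 H)%N.
Proof.
move=> YH; have -> : (Y * Y * \prod_(j < m) (Y ^ (m - j) %/ D) = #|{: index}|)%N.
  rewrite card_prod card_ord card_dep_ffun foldrE big_map big_enum /=.
  by congr (_ * _)%N; apply: eq_bigr => i _; rewrite card_ord.
apply: (@card_fset_set_inj _ _ _ _
  (fun x => homog m (fam_poly x) ('X^2 + (fam_rho x)%:R%:P) 'X)).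
- exact: finite_max_modulus_polys.
- by move=> x _; exact: fam_max_modulus.
- by move=> x y _ _; exact: fam_inj.
Qed.

End Family.

End EvenCount.

Section EvenLowerBound.

Variable R : realType.
Local Notation C := R[i].
Local Notation nc := (@Normc.normc R).

(** The witness X ^ n - 2 is taken as (X - 2) composed with X ^ n, so that the criteria for g(X ^ k)
    apply: 2 is no proper power. *)
Lemma all_max_modulus_count_gt0 (n H : nat) : (0 < n)%N -> (2 <= H)%N ->
  (0 < nb_max_modulus_polys R n n H)%N.
Proof.
move=> n0 H2; pose g : {poly int} := 'X - 2%:P.
have mg : g \is monic by exact: monicXsubC.
have sg : size g = 2%N by rewrite size_XsubC.
have fin := finite_max_modulus_polys R n n H.
apply: (@leq_trans #|{: unit}|); first by rewrite card_unit.
apply: (@card_fset_set_inj _ _ _ _ (fun=> g \Po 'X^n) fin) => [_ _|[] []//].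
split.
- exact: monic_comp_polyXn.
- have := size_comp_poly g 'X^n; rewrite sg size_polyXn /= mul1n => {2}<-.
  by rewrite prednK // size_poly_gt0 monic_neq0 // monic_comp_polyXn.
- apply/height_leP => i; rewrite coef_comp_poly_Xn //; case: ifP => // _.
  rewrite coefB coefX coefC; case: (_ %/ _)%N => [|[|j]] //=; lia.
- apply: irr_comp_polyXn => //.
    rewrite /g rmorphB /= map_polyX map_polyC; exact: irredp_XsubC.
  move=> y d /andP[d1 _]; rewrite coefB coefX coefC /=.
  case: y => [|[|y]] E; [by move: E; rewrite exp0n // ltnW|by move: E; rewrite exp1n|].
  have : (2 ^ 2 <= y.+2 ^ d)%N by apply: (@leq_trans (2 ^ d)); rewrite ?leq_exp2l ?leq_exp2r // ltnW.
  by rewrite -E.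
- apply: (one_large_root_comp_nb (B := 1)) => //.
  have [gE _] := monic_croots_intr R mg.
  have pc : perm_eq (croots (map_poly (intr : int -> C) g)) [:: 2].
    apply: prod_XsubC_eq; rewrite -gE big_seq1 /g rmorphB /= map_polyX map_polyC.
    by [].
  have nc2 : 1 <= nc 2 by rewrite (_ : 2 = 2%:~R) // nc_int ler1n.
  by rewrite (permP pc); transitivity ((1%R <= nc 2)%R + 0)%N; [|rewrite nc2].
Qed.

(** Each quotient is at least 1, so rounding it down loses at most a factor 2. *)
Lemma prod_expn_lower (m Y D : nat) : (0 < D)%N -> (D <= Y)%N ->
  (Y ^ (\sum_(j < m) (m - j)) <= (2 * D) ^ m * \prod_(j < m) (Y ^ (m - j) %/ D))%N.
Proof.
move=> D0 DY; have Y0 : (0 < Y)%N by exact: leq_trans DY.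
rewrite expn_sum -[X in ((2 * D) ^ X)%N]card_ord -prod_nat_const -big_split /=.
apply: leq_prod => j _; set X := (Y ^ (m - j))%N.
have DX : (D <= X)%N.
  rewrite (leq_trans DY) // /X -{1}(expn1 Y).
  by rewrite leq_pexp2l // subn_gt0.
have X1 : (1 <= X %/ D)%N by rewrite divn_gt0.
have := ltn_ceil X D0; nia.
Qed.

Lemma sum_sub_ord m : (2 * \sum_(j < m) (m - j) = m * m.+1)%N.
Proof.
elim: m => [|m IH]; first by rewrite big_ord0.
rewrite big_ord_recl /= subn0 mulnDr.
under eq_bigr do rewrite /bump /= add1n subSS.
by rewrite IH; lia.
Qed.

(* The family with (4Y) ^ n <= H < (4(Y+1)) ^ n has about Y ^ (2 + m(m+1)/2)
   members, where n = 2m; X ^ n - 2 takes care of small H. *)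
Lemma even_count_lower (n : nat) : (2 <= n)%N -> ~~ odd n ->
  exists2 c : R, 0 < c & forall H : nat, (1 <= H)%N ->
    (1 < H)%N || (0 < nb_max_modulus_polys R n n H)%N ->
    H%:R `^ (n%:R / 8 + 2 / n%:R + 1 / 4) <= c * (nb_max_modulus_polys R n n H)%:R.
Proof.
move=> n2 evn; pose m := n./2; have nE : n = m.*2 by rewrite even_halfK.
have m0 : (0 < m)%N by rewrite /m; case: (n) n2 => [|[|]].
pose E := (2 + \sum_(j < m) (m - j))%N.
have mR : 0 < m%:R :> R by rewrite ltr0n.
have eE : n%:R / 8 + 2 / n%:R + 1 / 4 = E%:R / n%:R :> R.
  have := congr1 (fun j => j%:R : R) (sum_sub_ord m).
  rewrite /E natrD !natrM -natr1; set S := (\sum_(j < m) _)%:R => SE.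
  have -> : S = m%:R * (m%:R + 1) / 2 by lra.
  by rewrite nE -mul2n natrM; field; rewrite gt_eqF.
rewrite {}eE; pose D := (8 * m * (2 * m) ^ m).+1.
pose H0 := ((4 * D) ^ n)%N; set e := E%:R / n%:R.
have e0 : 0 <= e by rewrite divr_ge0.
(* [c1] covers H < [H0], below which Y could be less than D. In [c2], 8 comes from 4 (Y + 1) <= 8 Y,
   and the powers of 2 D from the digit counts. *)
pose c1 : R := H0%:R `^ e; pose c2 : R := 8 ^+ E * (2 * D%:R) ^+ m.
have c10 : 0 <= c1 by exact: powR_ge0.
have c20 : 0 < c2 by rewrite mulr_gt0 // exprn_gt0 // mulr_gt0 // ltr0n.
exists (c1 + c2); first by lra.
move=> H H1 Hnb; set nb := nb_max_modulus_polys _ _ _ _ in Hnb *.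
have [small|big] := ltnP H H0.
  (* For H = 1 the count can vanish: its members have all roots on the unit circle, hence are
     cyclotomic by Kronecker's theorem, and 14, for instance, is not a value of Euler's function.
     Hence the disjunction in [Hnb]. *)
  have nb1 : 1 <= nb%:R :> R.
    rewrite ler1n; case/orP: Hnb => // H2; apply: all_max_modulus_count_gt0 => //.
    by rewrite ltnW.
  have Hc : H%:R `^ e <= c1 by rewrite ge0_ler_powR ?nnegrE // ler_nat ltnW.
  by nra.
have n0 : (0 < n)%N by rewrite ltnW.
have exY : exists Y, ((4 * Y) ^ n <= H)%N by exists 0%N; rewrite muln0 exp0n.
have ubY Y : ((4 * Y) ^ n <= H)%N -> (Y <= H)%N.
  apply: leq_trans; case: Y => // Y; apply: (@leq_trans (4 * Y.+1)); first by lia.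
  by rewrite -{1}(expn1 (4 * Y.+1)) leq_pexp2l.
case: (ex_maxnP exY ubY) => Y YH maxY.
have DY : (D <= Y)%N by exact: maxY.
have YH' : (H < (4 * Y.+1) ^ n)%N by rewrite ltnNge; apply/negP => /maxY; rewrite ltnn.
have Y0 : (0 < Y)%N by exact: leq_trans DY.
have HY : (2 ^ m.*2 * (2 * (Y * Y)) ^ m <= H)%N.
  apply: leq_trans YH; rewrite nE -mul2n !expnM -expnMn leq_exp2r //; lia.
have := fam_count R m0 DY (ltnSn _) HY; rewrite -nE -/nb => cnt.
have lowY : (Y ^ E <= (2 * D) ^ m * nb)%N.
  rewrite /E expnD -mulnn; apply: (@leq_trans (Y * Y * ((2 * D) ^ m * \prod_(j < m) (Y ^ (m - j) %/ D)))).
    by rewrite leq_mul2l prod_expn_lower ?orbT.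
  by rewrite mulnCA leq_mul2l cnt orbT.
have HE : H%:R `^ e <= 8 ^+ E * Y%:R ^+ E.
  apply: (@le_trans _ _ ((((4 * Y.+1) ^ n)%N%:R) `^ e)).
    by rewrite ge0_ler_powR ?nnegrE // ler_nat ltnW.
  rewrite natrX -powR_mulrn // -powRrM /e mulrCA divff ?pnatr_eq0 -?lt0n // mulr1.
  rewrite powR_mulrn // -exprMn -!natrM lerXn2r ?nnegrE // ler_nat; lia.
rewrite (le_trans HE) //.
have lowYR : Y%:R ^+ E <= (2 * D%:R) ^+ m * nb%:R :> R.
  by rewrite -natrX -natrM -natrX -natrM ler_nat.
apply: (@le_trans _ _ (c2 * nb%:R)).
  by rewrite /c2 -mulrA ler_pM2l // exprn_gt0.
by rewrite ler_wpM2r // lerDr.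
Qed.

End EvenLowerBound.

Theorem theorem1p2 (R : realType) (n : nat) (n_ge2 : (2 <= n)%N) :
  [/\ (forall k : nat, odd k -> (1 <= k <= n)%N ->
         ((k %| n)%N ->
            (fun H : nat => (nb_max_modulus_polys R n k H)%:R
                            / (2 * H%:R) `^ (n%:R / k%:R) : R) @ \oo --> (1 : R))
         /\ (~~ (k %| n)%N ->
            forall H : nat, (1 <= H)%N -> nb_max_modulus_polys R n k H = 0%N)),
      (forall k : nat, (1 <= k <= n)%N ->
         exists2 c : R, 0 < c &
           forall H : nat, (1 <= H)%N ->
             (nb_max_modulus_polys R n k H)%:R
               <= c * H%:R `^ (n%:R - (k%:R - 1) / 2))
    & (~~ odd n ->
         exists2 c : R, 0 < c &
           forall H : nat, (1 <= H)%N ->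
             (1 < H)%N || (0 < nb_max_modulus_polys R n n H)%N ->
             H%:R `^ (n%:R / 8 + 2 / n%:R + 1 / 4)
               <= c * (nb_max_modulus_polys R n n H)%:R)].
Proof.
split.
- move=> k oddk _; split=> [kn|kn H _]; first exact: odd_dvd_count_cvg.
  exact: odd_not_dvd_count0.
- exact: nb_max_modulus_polys_upper.
- exact: even_count_lower.
Qed.
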